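(* Let $\lambda_1\in\mathbb{C}\setminus\{0\}$ and let $\Lambda=[\lambda_1,e^{2\pi i/3}\lambda_1]$ be a triangular lattice such that every critical value of the Weierstrass function $\wp_\Lambda$ is a pole of $\wp_\Lambda$ (i.e. lies in $\Lambda$). For $\beta\in\mathbb{C}\setminus\{0\}$ let $g_\beta=\beta\wp_\Lambda$. Then the set of escaping parameters $$\mathcal{E}=\{\beta\in\mathbb{C}\setminus\{0\}:\ \lim_{n\to\infty}g_\beta^n(c_i)=\infty,\ i=1,2,3\}$$ satisfies $\dim_H(\mathcal{E})\ge 4/3$.
   Context: A lattice $\Lambda=[\lambda_1,\lambda_2]=\{l\lambda_1+m\lambda_2: l,m\in\mathbb{Z}\}$ with $\mathrm{Im}(\lambda_1/\lambda_2)\neq0$; it is triangular if $\lambda_2=e^{2\pi i/3}\lambda_1$. The Weierstrass function is $\wp_\Lambda(z)=\frac1{z^2}+\sum_{w\in\Lambda\setminus\{0\}}\big(\frac1{(z-w)^2}-\frac1{w^2}\big)$; it is $\Lambda$-periodic with double poles exactly at $\Lambda$. Its critical points modulo $\Lambda$ are $c_1=\lambda_1/2$, $c_2=\lambda_2/2$, $c_3=(\lambda_1+\lambda_2)/2$, and its critical values are $\wp_\Lambda(c_i)$. $g_\beta^n$ denotes the $n$-th iterate; the condition $g_\beta^n(c_i)\to\infty$ includes that all iterates $g_\beta^n(c_i)$ are finite. $\dim_H$ is Hausdorff dimension. *)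

(* Defs.v *)
From Stdlib Require Import Reals Lra Lia ZArith List.
Open Scope R_scope.

Definition Cplx : Type := (R * R)%type.
Definition Cre (z : Cplx) : R := fst z.
Definition Cim (z : Cplx) : R := snd z.
Definition C0 : Cplx := (0, 0).
Definition Cofr (x : R) : Cplx := (x, 0).
Definition Cadd (z w : Cplx) : Cplx := (Cre z + Cre w, Cim z + Cim w).
Definition Copp (z : Cplx) : Cplx := (- Cre z, - Cim z).
Definition Csub (z w : Cplx) : Cplx := Cadd z (Copp w).
Definition Cmul (z w : Cplx) : Cplx :=
  (Cre z * Cre w - Cim z * Cim w, Cre z * Cim w + Cim z * Cre w).
Definition Cnorm2 (z : Cplx) : R := Cre z * Cre z + Cim z * Cim z.
Definition Cinv (z : Cplx) : Cplx := (Cre z / Cnorm2 z, - Cim z / Cnorm2 z).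
Definition Cabs (z : Cplx) : R := sqrt (Cnorm2 z).

Definition omega : Cplx := (- (1/2), sqrt 3 / 2).

Definition in_lattice (l1 l2 z : Cplx) : Prop :=
  exists l m : Z, z = Cadd (Cmul (Cofr (IZR l)) l1) (Cmul (Cofr (IZR m)) l2).

Definition zrange (N : nat) : list Z :=
  map (fun k => (Z.of_nat k - Z.of_nat N)%Z) (seq 0 (2 * N + 1)).

Definition wp_term (l1 l2 z : Cplx) (l m : Z) : Cplx :=
  if (Z.eqb l 0 && Z.eqb m 0)%bool then C0 else
  let w := Cadd (Cmul (Cofr (IZR l)) l1) (Cmul (Cofr (IZR m)) l2) in
  Csub (Cinv (Cmul (Csub z w) (Csub z w))) (Cinv (Cmul w w)).

(** Partial sum of the (absolutely convergent) Weierstrass series over the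
    square |l|,|m| <= N. *)
Definition wp_partial (l1 l2 z : Cplx) (N : nat) : Cplx :=
  fold_right Cadd C0
    (flat_map (fun l => map (fun m => wp_term l1 l2 z l m) (zrange N)) (zrange N)).

Definition wp_at (l1 l2 z v : Cplx) : Prop :=
  ~ in_lattice l1 l2 z /\
  forall eps, 0 < eps -> exists N0 : nat, forall N : nat, (N0 <= N)%nat ->
    Cabs (Csub (Cadd (Cinv (Cmul z z)) (wp_partial l1 l2 z N)) v) < eps.

Definition crit_pt (l1 l2 : Cplx) (i : nat) : Cplx :=
  match i with
  | 1%nat => Cmul (Cofr (1/2)) l1
  | 2%nat => Cmul (Cofr (1/2)) l2
  | _ => Cmul (Cofr (1/2)) (Cadd l1 l2)
  end.

Definition escapes (l1 l2 beta c : Cplx) : Prop :=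
  exists x : nat -> Cplx,
    x 0%nat = c /\
    (forall n, exists v, wp_at l1 l2 (x n) v /\ x (S n) = Cmul beta v) /\
    (forall M, exists N : nat, forall n, (N <= n)%nat -> M < Cabs (x n)).

Definition escaping_params (l1 l2 : Cplx) (beta : Cplx) : Prop :=
  beta <> C0 /\ forall i, In i (1 :: 2 :: 3 :: nil)%nat -> escapes l1 l2 beta (crit_pt l1 l2 i).

(** s-dimensional Hausdorff measure vanishes:  H^s(E) = 0, i.e.
    for every delta > 0, H^s_delta(E) = inf { sum_k diam(U_k)^s : E ⊆ ∪ U_k,
    diam U_k <= delta } = 0. Diameters are bounded by radii r_k in (0, delta]
    (diam U_k <= r_k), which is harmless for s > 0. *)
Definition hausdorff_null (s : R) (E : Cplx -> Prop) : Prop :=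
  forall delta eps, 0 < delta -> 0 < eps ->
    exists (U : nat -> Cplx -> Prop) (r : nat -> R),
      (forall k, 0 < r k <= delta) /\
      (forall k x y, U k x -> U k y -> Cabs (Csub x y) <= r k) /\
      (forall z, E z -> exists k, U k z) /\
      (forall N, sum_f_R0 (fun k => Rpower (r k) s) N <= eps).

(** dim_H(E) = inf { s > 0 : H^s(E) = 0 } >= d. *)
Definition hausdorff_dim_ge (E : Cplx -> Prop) (d : R) : Prop :=
  forall s, 0 < s -> hausdorff_null s E -> d <= s.

(* Main.v *)
From Stdlib Require Import Reals Lra Lia ZArith List Psatz FinFun Classical ClassicalEpsilon.
From Coquelicot Require Import Coquelicot.
Require Import Defs.
Open Scope R_scope.

(** The rotation symmetry wp(omega z) = omega wp(z) and periodicity reduce the three critical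
    orbits to that of c = l1/2.  Its first iterate is beta e1 with e1 = wp(c) a nonzero
    lattice point, so z_1 = e1 + u_0 with beta = 1 + u_0/e1.  Given lattice points w_0, w_1,
    ... in a sector with |w_k| of order R_k = 4^(k+b), an orbit of the form
    z_(k+2) = w_k + u_(k+1) with all u_k small amounts to the system
        1/u_k^2 = (w_k + u_(k+1)) / (1 + u_0/e1) - h(u_k),    wp(u) = 1/u^2 + h(u),
    which, after taking inverse square roots, is a contraction in the space of bounded
    sequences once b is large.  So every itinerary is realised by an escaping parameter.

    A step of the orbit expands by at most a constant times R_k^(3/2), whence two parameters
    whose itineraries first differ at place n are at distance at least a multiple of
    C^(-n) (R_0 ... R_n)^(-3/2) |w_n - w'_n|.  There are R_k^2 choices of w_k, and the
    growth of R_k absorbs the factors C^n: this Cantor set has dimension at least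
    2 / (3/2) = 4/3.  The Hausdorff measure is bounded from below without measure theory: the
    k-th set of a cover kills a proportion at most C r_k^s of the itineraries, and if these
    proportions sum to less than 1 a greedy choice of letters avoids all the killed ones. *)

(** The Weierstrass function is given only as a limit of sums over squares in lattice coordinates.
    Neither the rotation nor the translations preserve these squares, so symmetry and periodicity
    are obtained by showing that the terms exchanged near the boundary contribute O(1/N).

    The exponent 3/2 is the size of the derivative: wp(u) of order R forces |u| of order R^(-1/2),
    and wp'(u) is about -2/u^3. The same exponent drives the fixed point. The inverse root contracts
    by R^(-3/2), while its argument moves by at most a multiple of R, because u_0 enters through
    beta, which divides the large number w_k. The composite has Lipschitz constant O(R^(-1/2)),
    hence the demand that b be large.

    With R_k = 4^(k+b) the product R_0 ... R_n is the exponential of a quadratic polynomial in n,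
    and any s < 4/3 leaves a positive quadratic coefficient, against which C^n is only linear in the
    exponent.

    The form beta = 1 + u_0/e1 needs e1 to be nonzero. Being a lattice point does not give this; a
    numerical estimate of wp at the half period does. *)

(** * Moduli and inverses of complex numbers *)

Lemma Cabs_Cmod (z : C) : Cabs z = Cmod z.
Proof. unfold Cabs, Cnorm2, Cre, Cim, Cmod. f_equal. ring. Qed.

Lemma DefsCinv_Cinv (z : C) : Defs.Cinv z = (/ z)%C.
Proof.
  unfold Defs.Cinv, Cnorm2, Cre, Cim, Complex.Cinv.
  replace (fst z * fst z + snd z * snd z) with (fst z ^ 2 + snd z ^ 2) by ring.
  reflexivity.
Qed.

Lemma Cinv_0 : (/ 0 = 0)%C.
Proof. unfold Complex.Cinv, RtoC. simpl. apply injective_projections; simpl; unfold Rdiv; ring. Qed.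

Lemma Cinv_mult_total (x y : C) : (/ (x * y) = / x * / y)%C.
Proof.
  destruct (Ceq_dec x 0) as [->|Hx]; [|destruct (Ceq_dec y 0) as [->|Hy]].
  - now rewrite Cmult_0_l, Cinv_0, Cmult_0_l.
  - now rewrite Cmult_0_r, Cinv_0, Cmult_0_r.
  - now field.
Qed.

Lemma Cmod_inv_total (x : C) : Cmod (/ x) = / Cmod x.
Proof.
  destruct (Ceq_dec x 0) as [->|Hx].
  - now rewrite Cinv_0, Cmod_0, Rinv_0.
  - now apply Cmod_inv.
Qed.

Lemma Cmod_minus_sym (x y : C) : Cmod (x - y) = Cmod (y - x).
Proof. rewrite <- Cmod_opp. f_equal. ring. Qed.

Lemma Cmod_triangle_minus (x y : C) : Cmod (x - y) <= Cmod x + Cmod y.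
Proof. unfold Cminus. rewrite <- (Cmod_opp y). apply Cmod_triangle. Qed.

Lemma Cmod_triangle_rev (x y : C) : Cmod x - Cmod y <= Cmod (x - y).
Proof.
  pose proof (Cmod_triangle (x - y) y). replace (x - y + y)%C with x in H by ring. lra.
Qed.

Lemma Cmod_triangle3 (x y z : C) : Cmod (x - z) <= Cmod (x - y) + Cmod (y - z).
Proof. replace (x - z)%C with ((x - y) + (y - z))%C by ring. apply Cmod_triangle. Qed.

Lemma Cmod_neq_0 (x : C) : 0 < Cmod x -> x <> 0.
Proof. intros H E. rewrite E, Cmod_0 in H. lra. Qed.

Lemma Im_le_Cmod (c : C) : Rabs (Im c) <= Cmod c.
Proof. eapply Rle_trans; [apply Rmax_r|apply Rmax_Cmod]. Qed.

(** * Symmetric sums over the integers *)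

Fixpoint zsum (f : Z -> C) (N : nat) : C :=
  match N with
  | O => f 0%Z
  | S n => (zsum f n + (f (Z.of_nat (S n)) + f (- Z.of_nat (S n))%Z))%C
  end.

(** The order of summation is the one fixed by [wp_at]: squares |l|, |m| <= N in lattice
    coordinates. *)
Definition zsum2 (g : Z -> Z -> C) (N : nat) : C := zsum (fun l => zsum (g l) N) N.

Lemma zsum_ext f g N :
  (forall l, (Z.abs l <= Z.of_nat N)%Z -> f l = g l) -> zsum f N = zsum g N.
Proof.
  induction N as [|N IH]; intros H; cbn [zsum].
  - apply H. simpl. lia.
  - rewrite IH, (H (Z.of_nat (S N))), (H (- Z.of_nat (S N))%Z); auto; try lia.
    intros; apply H; lia.
Qed.

Lemma zsum_plus f g N : (zsum (fun l => f l + g l) N = zsum f N + zsum g N)%C.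
Proof. induction N as [|N IH]; cbn [zsum]; [|rewrite IH]; ring. Qed.

Lemma zsum_minus f g N : (zsum (fun l => f l - g l) N = zsum f N - zsum g N)%C.
Proof. induction N as [|N IH]; cbn [zsum]; [|rewrite IH]; ring. Qed.

Lemma zsum_scal c f N : (zsum (fun l => c * f l) N = c * zsum f N)%C.
Proof. induction N as [|N IH]; cbn [zsum]; [|rewrite IH]; ring. Qed.

Lemma zsum_opp f N : zsum (fun l => f (- l)%Z) N = zsum f N.
Proof.
  induction N as [|N IH]; cbn [zsum]; auto.
  rewrite IH. replace (- - Z.of_nat (S N))%Z with (Z.of_nat (S N)) by lia.
  simpl. ring.
Qed.

Lemma zsum_swap (g : Z -> Z -> C) N M :
  zsum (fun l => zsum (g l) N) M = zsum (fun m => zsum (fun l => g l m) M) N.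
Proof.
  induction M as [|M IH]; cbn [zsum]; auto.
  rewrite IH. rewrite <- !zsum_plus. reflexivity.
Qed.

Lemma zsum_bound f N B :
  (forall l, (Z.abs l <= Z.of_nat N)%Z -> Cmod (f l) <= B) ->
  Cmod (zsum f N) <= (2 * INR N + 1) * B.
Proof.
  induction N as [|N IH]; intros H.
  - simpl. specialize (H 0%Z). simpl in H. lra || (assert (Cmod (f 0%Z) <= B) by (apply H; lia); lra).
  - cbn [zsum].
    assert (Cmod (zsum f N) <= (2 * INR N + 1) * B) by (apply IH; intros; apply H; lia).
    assert (Cmod (f (Z.of_nat (S N))) <= B) by (apply H; lia).
    assert (Cmod (f (- Z.of_nat (S N))%Z) <= B) by (apply H; lia).
    rewrite S_INR.
    eapply Rle_trans; [apply Cmod_triangle|].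
    pose proof (Cmod_triangle (f (Z.of_nat (S N))) (f (- Z.of_nat (S N))%Z)).
    lra.
Qed.

Lemma zsum_shift1 f N :
  (zsum (fun m => f (m - 1)%Z) N
   = zsum f N + (f (- Z.of_nat N - 1)%Z - f (Z.of_nat N)))%C.
Proof.
  induction N as [|N IH]; cbn [zsum].
  - simpl. ring.
  - rewrite IH.
    replace (Z.of_nat (S N) - 1)%Z with (Z.of_nat N) by lia.
    replace (- Z.of_nat (S N))%Z with (- Z.of_nat N - 1)%Z by lia.
    ring.
Qed.

(** Moving the window by k exchanges k terms at each end, all of index beyond N - k, so only the
    decay of f near the boundary enters. *)
Lemma zsum_shift_bound_pos f N (k : nat) B :
  (forall p, (Z.of_nat N - Z.of_nat k < Z.abs p)%Z -> Cmod (f p) <= B) ->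
  Cmod (zsum (fun m => f (m - Z.of_nat k)%Z) N - zsum f N) <= 2 * INR k * B.
Proof.
  revert f. induction k as [|k IH]; intros f H.
  - replace (zsum (fun m => f (m - Z.of_nat 0)%Z) N) with (zsum f N).
    + replace (zsum f N - zsum f N)%C with (RtoC 0) by ring. rewrite Cmod_0. simpl. lra.
    + apply zsum_ext. intros. f_equal. lia.
  - set (g := fun m => f (m - Z.of_nat k)%Z).
    replace (zsum (fun m => f (m - Z.of_nat (S k))%Z) N)
      with (zsum (fun m => g (m - 1)%Z) N)
      by (apply zsum_ext; intros; unfold g; f_equal; lia).
    rewrite zsum_shift1.
    assert (H1 : Cmod (zsum g N - zsum f N) <= 2 * INR k * B)
      by (apply IH; intros; apply H; lia).
    assert (H2 : Cmod (g (- Z.of_nat N - 1)%Z) <= B) by (apply H; lia).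
    assert (H3 : Cmod (g (Z.of_nat N)) <= B) by (apply H; lia).
    rewrite S_INR.
    match goal with |- Cmod ?x <= _ =>
      replace x with ((zsum g N - zsum f N) + (g (- Z.of_nat N - 1)%Z - g (Z.of_nat N)))%C by ring end.
    eapply Rle_trans; [apply Cmod_triangle|].
    pose proof (Cmod_triangle_minus (g (- Z.of_nat N - 1)%Z) (g (Z.of_nat N))). lra.
Qed.

Lemma zsum_shift_bound f N (k : Z) B :
  (forall p, (Z.of_nat N - Z.abs k < Z.abs p)%Z -> Cmod (f p) <= B) ->
  Cmod (zsum (fun m => f (m - k)%Z) N - zsum f N) <= 2 * IZR (Z.abs k) * B.
Proof.
  intros H. rewrite <- (Zabs2Nat.id_abs k), <- INR_IZR_INZ.
  destruct (Z_le_dec 0 k) as [Hk|Hk].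
  - replace (zsum (fun m => f (m - k)%Z) N)
      with (zsum (fun m => f (m - Z.of_nat (Z.abs_nat k))%Z) N)
      by (apply zsum_ext; intros; f_equal; lia).
    apply zsum_shift_bound_pos. intros; apply H; lia.
  - rewrite <- (zsum_opp (fun m => f (m - k)%Z)), <- (zsum_opp f).
    replace (zsum (fun m => f (- m - k)%Z) N)
      with (zsum (fun m => (fun p => f (- p)%Z) (m - Z.of_nat (Z.abs_nat k))%Z) N)
      by (apply zsum_ext; intros; f_equal; lia).
    apply (zsum_shift_bound_pos (fun p => f (- p)%Z)). intros; apply H; lia.
Qed.

Lemma zsum_center f N :
  (zsum f N = f 0%Z + zsum (fun l => if Z.eqb l 0 then RtoC 0 else f l) N)%C.
Proof.
  induction N as [|N IH]; cbn [zsum].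
  - simpl. ring.
  - rewrite IH. simpl. ring.
Qed.

Lemma zsum2_center g N :
  (zsum2 g N = g 0%Z 0%Z +
   zsum2 (fun l m => if (Z.eqb l 0 && Z.eqb m 0)%bool then RtoC 0 else g l m) N)%C.
Proof.
  unfold zsum2. rewrite (zsum_center (fun l => zsum (g l) N)).
  rewrite (zsum_center (fun l => zsum (fun m => if ((l =? 0)%Z && (m =? 0)%Z)%bool then _ else _) N)).
  simpl. rewrite (zsum_center (g 0%Z)). rewrite <- Cplus_assoc. f_equal. f_equal.
  apply zsum_ext. intros l _. destruct (Z.eqb_spec l 0) as [->|Hl]; auto.
Qed.

Lemma zsum2_ext f g N :
  (forall l m, (Z.abs l <= Z.of_nat N)%Z -> (Z.abs m <= Z.of_nat N)%Z -> f l m = g l m) ->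
  zsum2 f N = zsum2 g N.
Proof. intros H. apply zsum_ext. intros l Hl. apply zsum_ext. intros m Hm. auto. Qed.

Lemma zsum2_minus f g N : (zsum2 (fun l m => f l m - g l m) N = zsum2 f N - zsum2 g N)%C.
Proof. unfold zsum2. rewrite <- zsum_minus. apply zsum_ext. intros. apply zsum_minus. Qed.

Lemma zsum2_plus f g N : (zsum2 (fun l m => f l m + g l m) N = zsum2 f N + zsum2 g N)%C.
Proof. unfold zsum2. rewrite <- zsum_plus. apply zsum_ext. intros. apply zsum_plus. Qed.

Lemma zsum2_scal c f N : (zsum2 (fun l m => c * f l m) N = c * zsum2 f N)%C.
Proof. unfold zsum2. rewrite <- zsum_scal. apply zsum_ext. intros. apply zsum_scal. Qed.

Lemma zsum2_opp g N : zsum2 (fun l m => g (- l)%Z (- m)%Z) N = zsum2 g N.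
Proof.
  unfold zsum2. rewrite <- (zsum_opp (fun l => zsum (g l) N)).
  apply zsum_ext. intros. apply zsum_opp.
Qed.

Lemma zsum2_step g N :
  (zsum2 g (S N) = zsum2 g N +
   (zsum (fun l => g l (Z.of_nat (S N)) + g l (- Z.of_nat (S N))%Z) N +
    (zsum (g (Z.of_nat (S N))) (S N) + zsum (g (- Z.of_nat (S N))%Z) (S N))))%C.
Proof.
  unfold zsum2. cbn [zsum]. rewrite !zsum_plus. ring.
Qed.

(** The square shell of radius N + 1 has exactly 8 (N + 1) points, each contributing at most A / (N
    + 1)^3. *)
Lemma zsum2_shell g N A K :
  (forall l m (k : nat), (K < k)%nat -> (Z.abs l = Z.of_nat k \/ Z.abs m = Z.of_nat k) ->
     Cmod (g l m) <= A / INR k ^ 3) ->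
  (K <= N)%nat -> 0 <= A ->
  Cmod (zsum2 g (S N) - zsum2 g N) <= 8 * A / INR (S N) ^ 2.
Proof.
  intros H HN HA. rewrite zsum2_step.
  match goal with |- Cmod (?a + ?b - ?a) <= _ => replace (a + b - a)%C with b by ring end.
  set (B := A / INR (S N) ^ 3).
  assert (Hk : 0 < INR (S N)) by (apply lt_0_INR; lia).
  assert (HB : 8 * A / INR (S N) ^ 2 = 8 * INR (S N) * B) by (unfold B; field; lra).
  rewrite HB.
  assert (H1 : Cmod (zsum (fun l => g l (Z.of_nat (S N)) + g l (- Z.of_nat (S N))%Z)%C N)
     <= (2 * INR N + 1) * (B + B)).
  { apply zsum_bound. intros l Hl. eapply Rle_trans; [apply Cmod_triangle|].
    apply Rplus_le_compat; apply H; try lia. }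
  assert (H2 : Cmod (zsum (g (Z.of_nat (S N))) (S N)) <= (2 * INR (S N) + 1) * B).
  { apply zsum_bound. intros l Hl. apply H; lia. }
  assert (H3 : Cmod (zsum (g (- Z.of_nat (S N))%Z) (S N)) <= (2 * INR (S N) + 1) * B).
  { apply zsum_bound. intros l Hl. apply H; lia. }
  eapply Rle_trans; [apply Cmod_triangle|].
  match goal with |- ?a + Cmod (?x + ?y) <= _ => pose proof (Cmod_triangle x y) end.
  rewrite S_INR in *. lra.
Qed.

(** The shell bounds telescope through 1/x^2 <= 1/(x - 1/2) - 1/(x + 1/2). The half-integer offset
    keeps the bound finite at N = 0 and makes it sharp enough for the numerical estimate at the half
    period, where the cruder 1/N would fail. *)
Lemma zsum2_tail g A K :
  (forall l m (k : nat), (K < k)%nat -> (Z.abs l = Z.of_nat k \/ Z.abs m = Z.of_nat k) ->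
     Cmod (g l m) <= A / INR k ^ 3) ->
  0 <= A ->
  forall N, (K <= N)%nat -> forall p,
  Cmod (zsum2 g (N + p) - zsum2 g N) <= 8 * A * (/ (INR N + 1/2) - / (INR (N + p) + 1/2)).
Proof.
  intros H HA N HN p. induction p as [|p IH].
  - rewrite Nat.add_0_r. replace (zsum2 g N - zsum2 g N)%C with (RtoC 0) by ring.
    rewrite Cmod_0. lra.
  - eapply Rle_trans; [apply (Cmod_triangle3 _ (zsum2 g (N + p)))|].
    replace (N + S p)%nat with (S (N + p)) by lia.
    pose proof (zsum2_shell g (N + p) A K H ltac:(lia) HA) as Hs.
    assert (Hp := pos_INR (N + p)). rewrite S_INR in *. set (x := INR (N + p)) in *.
    assert (8 * A / (x + 1) ^ 2 <= 8 * A * (/ (x + 1/2) - / (x + 1 + 1/2))).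
    { unfold Rdiv at 1. apply Rmult_le_compat_l; [lra|].
      replace (/ (x + 1 / 2) - / (x + 1 + 1 / 2)) with (/ ((x+1)^2 - 1/4)) by (field; nra).
      apply Rinv_le_contravar; nra. }
    lra.
Qed.

(** * The Weierstrass function of a triangular lattice *)

Lemma omega_sq : (omega * omega = - (1) - omega)%C.
Proof.
  assert (H : sqrt 3 * sqrt 3 = 3) by (apply sqrt_sqrt; lra).
  unfold omega, Cminus, Complex.Copp, Cplus, Cmult, RtoC. simpl.
  apply injective_projections; simpl; nra.
Qed.

Lemma omega_cube : (omega * omega * omega = 1)%C.
Proof.
  rewrite omega_sq. replace ((- (1) - omega) * omega)%C with (- omega - omega * omega)%C by ring.
  rewrite omega_sq. ring.
Qed.

Lemma omega_neq0 : omega <> RtoC 0.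
Proof. intros H. pose proof omega_cube as E. rewrite H in E. rewrite !Cmult_0_l in E. now apply C1_nz. Qed.

Lemma Cmod_omega : Cmod omega = 1.
Proof.
  pose proof (f_equal Cmod omega_cube) as H. rewrite !Cmod_mult, Cmod_1 in H.
  pose proof (Cmod_ge_0 omega). nra.
Qed.

(** * Lattice points and the Eisenstein norm form *)

Definition lat (l1 : C) (l m : Z) : C := (RtoC (IZR l) * l1 + RtoC (IZR m) * (omega * l1))%C.

Lemma lat_eq l1 l m : lat l1 l m = ((RtoC (IZR l) + RtoC (IZR m) * omega) * l1)%C.
Proof. unfold lat. ring. Qed.

Lemma lat_plus l1 l m l' m' : (lat l1 l m + lat l1 l' m' = lat l1 (l + l') (m + m'))%C.
Proof. unfold lat. rewrite !plus_IZR, !RtoC_plus. ring. Qed.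

Lemma lat_00 l1 : lat l1 0 0 = 0.
Proof. unfold lat. ring. Qed.

Lemma lat_omega l1 l m : (omega * lat l1 (m - l) (- l) = lat l1 l m)%C.
Proof.
  rewrite !lat_eq, minus_IZR, opp_IZR, RtoC_minus, RtoC_opp.
  replace (omega * ((IZR m - IZR l + - IZR l * omega) * l1))%C
    with (((IZR m - IZR l) * omega - IZR l * (omega * omega)) * l1)%C by ring.
  rewrite omega_sq. ring.
Qed.

Lemma Cmod_lat_sq l1 l m :
  Cmod (lat l1 l m) ^ 2 = (IZR l ^ 2 - IZR l * IZR m + IZR m ^ 2) * Cmod l1 ^ 2.
Proof.
  rewrite lat_eq, Cmod_mult, Rpow_mult_distr. f_equal.
  rewrite Cmod2_alt. assert (H : sqrt 3 * sqrt 3 = 3) by (apply sqrt_sqrt; lra).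
  unfold omega, RtoC, Cplus, Cmult, Re, Im. simpl. nra.
Qed.

(** Completing the square gives l^2 - l m + m^2 = 3/4 l^2 + (m - l/2)^2, and likewise with l and m
    exchanged. *)
Lemma quadratic_form_lower l m (k : nat) :
  (Z.of_nat k <= Z.abs l \/ Z.of_nat k <= Z.abs m)%Z ->
  3/4 * INR k ^ 2 <= IZR l ^ 2 - IZR l * IZR m + IZR m ^ 2.
Proof.
  intros H. assert (Hk := pos_INR k).
  assert (HH : INR k <= Rabs (IZR l) \/ INR k <= Rabs (IZR m)).
  { rewrite INR_IZR_INZ, <- !abs_IZR. destruct H; [left|right]; now apply IZR_le. }
  assert (HS : INR k ^ 2 <= IZR l ^ 2 \/ INR k ^ 2 <= IZR m ^ 2).
  { rewrite <- (pow2_abs (IZR l)), <- (pow2_abs (IZR m)).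
    destruct HH; [left|right]; apply pow_incr; lra. }
  pose proof (pow2_ge_0 (IZR l - 2 * IZR m)). pose proof (pow2_ge_0 (IZR m - 2 * IZR l)).
  destruct HS; nra.
Qed.

(** The factor 3/4 is a rational number below the sharp value sqrt 3 / 2. *)
Lemma lat_lower l1 l m (k : nat) :
  (Z.of_nat k <= Z.abs l \/ Z.of_nat k <= Z.abs m)%Z ->
  3/4 * INR k * Cmod l1 <= Cmod (lat l1 l m).
Proof.
  intros H. pose proof (quadratic_form_lower l m k H) as Hq.
  pose proof (Cmod_lat_sq l1 l m) as E.
  pose proof (Cmod_ge_0 l1). pose proof (Cmod_ge_0 (lat l1 l m)). pose proof (pos_INR k).
  apply Rsqr_incr_0_var; auto. unfold Rsqr.
  assert (INR k ^ 2 * Cmod l1 ^ 2 * (3/4) <= Cmod (lat l1 l m) ^ 2).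
  { rewrite E. pose proof (pow2_ge_0 (Cmod l1)). nra. }
  pose proof (pow2_ge_0 (INR k * Cmod l1)). nra.
Qed.

Lemma lat_1_lower l1 l m : (l, m) <> (0, 0)%Z -> 3/4 * Cmod l1 <= Cmod (lat l1 l m).
Proof.
  intros H. replace (3/4 * Cmod l1) with (3/4 * INR 1 * Cmod l1) by (simpl; ring).
  apply lat_lower. destruct (Z.eq_dec l 0), (Z.eq_dec m 0); try lia. subst. congruence.
Qed.

(** Since [/ 0 = 0], the term at the origin is 1/z^2. The sum of [wt] over the full square is
    therefore the whole partial sum for wp, with no exceptional index. *)
Definition wt (l1 z : C) (l m : Z) : C :=
  (/ ((z - lat l1 l m) * (z - lat l1 l m)) - / (lat l1 l m * lat l1 l m))%C.

Definition wt0 (l1 z : C) (l m : Z) : C :=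
  if (Z.eqb l 0 && Z.eqb m 0)%bool then RtoC 0 else wt l1 z l m.

Lemma wp_term_wt0 l1 z l m : wp_term l1 (Cmul omega l1) z l m = wt0 l1 z l m.
Proof.
  unfold wp_term, wt0. destruct (_ && _)%bool; [reflexivity|].
  cbv zeta. rewrite !DefsCinv_Cinv. reflexivity.
Qed.

Lemma zrange_S N :
  zrange (S N) = ((- Z.of_nat (S N))%Z :: nil) ++ zrange N ++ (Z.of_nat (S N) :: nil).
Proof.
  unfold zrange. replace (2 * S N + 1)%nat with (1 + ((2 * N + 1) + 1))%nat by lia.
  rewrite (seq_app 1), (seq_app (2 * N + 1) 1 (0 + 1)), !map_app. apply (f_equal2 (@app Z)); [|apply (f_equal2 (@app Z))].
  - reflexivity.
  - change (0 + 1)%nat with 1%nat. rewrite <- seq_shift, map_map. apply map_ext. intros; lia.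
  - cbn [seq map]. f_equal. lia.
Qed.

Definition csum (l : list C) : C := fold_right Cadd C0 l.

Lemma csum_app l l' : (csum (l ++ l') = csum l + csum l')%C.
Proof.
  induction l as [|a l IH]; simpl.
  - change (@eq C (csum l') (RtoC 0 + csum l')%C). ring.
  - change (@eq C (a + csum (l ++ l'))%C (a + csum l + csum l')%C). rewrite IH. ring.
Qed.

Lemma csum_flat_map {A} (f : A -> list C) l : csum (flat_map f l) = csum (map (fun x => csum (f x)) l).
Proof. induction l as [|a l IH]; simpl; auto. rewrite csum_app, IH. reflexivity. Qed.

Lemma csum_zrange f N : csum (map f (zrange N)) = zsum f N.
Proof.
  induction N as [|N IH].
  - change (@eq C (f 0%Z + RtoC 0)%C (f 0%Z)). ring.
  - rewrite zrange_S, !map_app, !csum_app, IH. cbn [map zsum].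
    unfold csum at 1 2. cbn [fold_right].
    change ((f (- Z.of_nat (S N))%Z + RtoC 0 + (zsum f N + (f (Z.of_nat (S N)) + RtoC 0))
      = zsum f N + (f (Z.of_nat (S N)) + f (- Z.of_nat (S N))%Z))%C). ring.
Qed.

Lemma wp_partial_zsum2 l1 z N :
  wp_partial l1 (Cmul omega l1) z N = zsum2 (wt0 l1 z) N.
Proof.
  unfold wp_partial. change (fold_right Cadd C0) with csum.
  rewrite csum_flat_map, csum_zrange. apply zsum_ext. intros l _.
  rewrite csum_zrange. apply zsum_ext. intros m _. apply wp_term_wt0.
Qed.

(** * Limits of complex sequences *)

Definition clim (a : nat -> C) (v : C) : Prop :=
  forall eps, 0 < eps -> exists N0 : nat, forall N, (N0 <= N)%nat -> Cmod (a N - v) < eps.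

Lemma zsum2_wt l1 z N : (zsum2 (wt l1 z) N = / (z * z) + zsum2 (wt0 l1 z) N)%C.
Proof.
  rewrite zsum2_center. f_equal. unfold wt. rewrite lat_00, Cmult_0_l, Cinv_0.
  replace (z - 0)%C with z by ring. ring.
Qed.

Lemma wp_at_clim l1 z v :
  wp_at l1 (Cmul omega l1) z v <->
  ~ in_lattice l1 (Cmul omega l1) z /\ clim (zsum2 (wt l1 z)) v.
Proof.
  unfold wp_at, clim. split; intros [H1 H2]; split; auto; intros eps He;
    destruct (H2 eps He) as [N0 HN]; exists N0; intros N HN0; specialize (HN N HN0).
  - rewrite zsum2_wt. rewrite Cabs_Cmod, wp_partial_zsum2, DefsCinv_Cinv in HN. exact HN.
  - rewrite Cabs_Cmod, wp_partial_zsum2, DefsCinv_Cinv. rewrite zsum2_wt in HN. exact HN.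
Qed.

Lemma clim_close a b v :
  clim a v -> (forall eps, 0 < eps -> exists N0 : nat, forall N, (N0 <= N)%nat -> Cmod (b N - a N) < eps) ->
  clim b v.
Proof.
  intros Ha Hb eps He. destruct (Ha (eps/2)) as [N1 H1]; [lra|].
  destruct (Hb (eps/2)) as [N2 H2]; [lra|]. exists (max N1 N2). intros N HN.
  specialize (H1 N ltac:(lia)). specialize (H2 N ltac:(lia)).
  eapply Rle_lt_trans; [apply (Cmod_triangle3 _ (a N))|]. lra.
Qed.

Lemma clim_scal c a v : clim a v -> clim (fun N => c * a N)%C (c * v)%C.
Proof.
  intros Ha eps He. pose proof (Cmod_ge_0 c).
  destruct (Ha (eps / (Cmod c + 1))) as [N0 HN]; [apply Rdiv_lt_0_compat; lra|].
  exists N0. intros N H0. specialize (HN N H0).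
  replace (c * a N - c * v)%C with (c * (a N - v))%C by ring. rewrite Cmod_mult.
  apply (Rmult_lt_compat_l (Cmod c + 1)) in HN; [|lra].
  replace ((Cmod c + 1) * (eps / (Cmod c + 1))) with eps in HN by (field; lra).
  pose proof (Cmod_ge_0 (a N - v)). nra.
Qed.

Lemma clim_unique a v v' : clim a v -> clim a v' -> v = v'.
Proof.
  intros H H'. apply NNPP. intros Hn.
  assert (Hp : 0 < Cmod (v - v')).
  { apply Cmod_gt_0. intros E. apply Hn. apply Ceq_minus. exact E. }
  destruct (H (Cmod (v - v') / 2)) as [N1 H1]; [lra|].
  destruct (H' (Cmod (v - v') / 2)) as [N2 H2]; [lra|].
  specialize (H1 (max N1 N2) ltac:(lia)). specialize (H2 (max N1 N2) ltac:(lia)).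
  pose proof (Cmod_triangle3 v (a (max N1 N2)) v'). rewrite (Cmod_minus_sym v (a (max N1 N2))) in H0. lra.
Qed.

Lemma clim_cauchy (a : nat -> C) :
  (forall eps, 0 < eps -> exists N0 : nat, forall p q, (N0 <= p)%nat -> (N0 <= q)%nat -> Cmod (a p - a q) < eps) ->
  exists v, clim a v.
Proof.
  intros H.
  destruct (Rcomplete.R_complete (fun n => Re (a n))) as [x Hx].
  { intros eps He. destruct (H eps He) as [N0 HN]. exists N0. intros p q Hp Hq.
    unfold Rdist. eapply Rle_lt_trans; [|apply (HN p q Hp Hq)].
    replace (Re (a p) - Re (a q)) with (Re (a p - a q)) by reflexivity. apply re_le_Cmod. }
  destruct (Rcomplete.R_complete (fun n => Im (a n))) as [y Hy].
  { intros eps He. destruct (H eps He) as [N0 HN]. exists N0. intros p q Hp Hq.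
    unfold Rdist. eapply Rle_lt_trans; [|apply (HN p q Hp Hq)].
    replace (Im (a p) - Im (a q)) with (Im (a p - a q)) by reflexivity. apply Im_le_Cmod. }
  exists (x, y). intros eps He.
  destruct (Hx (eps / 2)) as [N1 H1]; [lra|]. destruct (Hy (eps / 2)) as [N2 H2]; [lra|].
  exists (max N1 N2). intros N HN.
  specialize (H1 N ltac:(lia)). specialize (H2 N ltac:(lia)). unfold Rdist in *.
  eapply Rle_lt_trans; [apply Cmod_2Rmax|].
  change (fst (a N - (x, y))%C) with (Re (a N) - x). change (snd (a N - (x, y))%C) with (Im (a N) - y).
  assert (sqrt 2 < 2). { rewrite <- (sqrt_square 2) at 2 by lra. apply sqrt_lt_1; lra. }
  assert (Rmax (Rabs (Re (a N) - x)) (Rabs (Im (a N) - y)) < eps / 2) by now apply Rmax_lub_lt.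
  pose proof (Rabs_pos (Re (a N) - x)). pose proof (Rmax_l (Rabs (Re (a N) - x)) (Rabs (Im (a N) - y))).
  pose proof (sqrt_pos 2). nra.
Qed.

(** * Decay of the terms of the series *)

(** The difference is (v - u) (u + v - 2w) / ((u - w)^2 (v - w)^2). The constant is 3 * 2^4: the
    second factor is at most 3 |w|, and each of the four inverse factors is at most 2 / |w|. *)
Lemma inv_sq_diff (u v w : C) :
  0 < Cmod w -> Cmod u <= Cmod w / 2 -> Cmod v <= Cmod w / 2 ->
  Cmod (/ ((u - w) * (u - w)) - / ((v - w) * (v - w))) <= 48 * Cmod (u - v) / Cmod w ^ 3.
Proof.
  intros Hw Hu Hv.
  assert (H1 : Cmod w / 2 <= Cmod (u - w)).
  { rewrite Cmod_minus_sym. pose proof (Cmod_triangle_rev w u). lra. }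
  assert (H2 : Cmod w / 2 <= Cmod (v - w)).
  { rewrite Cmod_minus_sym. pose proof (Cmod_triangle_rev w v). lra. }
  assert (N1 : (u - w)%C <> 0) by (apply Cmod_neq_0; lra).
  assert (N2 : (v - w)%C <> 0) by (apply Cmod_neq_0; lra).
  replace (/ ((u - w) * (u - w)) - / ((v - w) * (v - w)))%C
    with ((v - u) * (u + v - 2 * w) * (/ (u - w) * / (u - w) * (/ (v - w) * / (v - w))))%C
    by (field; auto).
  rewrite !Cmod_mult, !Cmod_inv_total, (Cmod_minus_sym v u).
  assert (I1 : / Cmod (u - w) <= 2 / Cmod w).
  { replace (2 / Cmod w) with (/ (Cmod w / 2)) by (field; lra). apply Rinv_le_contravar; lra. }
  assert (I2 : / Cmod (v - w) <= 2 / Cmod w).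
  { replace (2 / Cmod w) with (/ (Cmod w / 2)) by (field; lra). apply Rinv_le_contravar; lra. }
  assert (P1 : 0 < / Cmod (u - w)) by (apply Rinv_0_lt_compat; lra).
  assert (P2 : 0 < / Cmod (v - w)) by (apply Rinv_0_lt_compat; lra).
  assert (H3 : Cmod (u + v - 2 * w) <= 3 * Cmod w).
  { eapply Rle_trans; [apply Cmod_triangle_minus|]. rewrite Cmod_mult, Cmod_R, Rabs_right by lra.
    pose proof (Cmod_triangle u v). lra. }
  replace (48 * Cmod (u - v) / Cmod w ^ 3)
    with (Cmod (u - v) * (3 * Cmod w) * (2 / Cmod w * (2 / Cmod w) * (2 / Cmod w * (2 / Cmod w))))
    by (field; lra).
  pose proof (Cmod_ge_0 (u - v)). pose proof (Cmod_ge_0 (u + v - 2 * w)).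
  assert (0 < 2 / Cmod w) by (apply Rdiv_lt_0_compat; lra).
  repeat apply Rmult_le_compat; try lra; try (repeat apply Rmult_le_pos; lra).
Qed.

Lemma inv_sq_bound (z w : C) : 0 < Cmod w -> Cmod z <= Cmod w / 2 ->
  Cmod (/ ((z - w) * (z - w))) <= 4 / Cmod w ^ 2.
Proof.
  intros Hw Hz.
  assert (H1 : Cmod w / 2 <= Cmod (z - w)).
  { rewrite Cmod_minus_sym. pose proof (Cmod_triangle_rev w z). lra. }
  rewrite Cmod_inv_total, Cmod_mult.
  replace (4 / Cmod w ^ 2) with (/ (Cmod w / 2 * (Cmod w / 2))) by (field; lra).
  apply Rinv_le_contravar; nra.
Qed.

(** The parts 1/w^2 cancel. The radius 3/8 is half of the 3/4 in [lat_lower], and 114 rounds up 48 *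
    (4/3)^3. *)
Lemma wt_diff (l1 u v : C) l m (k : nat) : l1 <> RtoC 0 -> (0 < k)%nat ->
  (Z.of_nat k <= Z.abs l \/ Z.of_nat k <= Z.abs m)%Z ->
  Cmod u <= 3/8 * INR k * Cmod l1 -> Cmod v <= 3/8 * INR k * Cmod l1 ->
  Cmod (wt l1 u l m - wt l1 v l m) <= 114 / Cmod l1 ^ 3 * Cmod (u - v) / INR k ^ 3.
Proof.
  intros Hl Hk H Hu Hv. pose proof (lat_lower l1 l m k H) as Hw.
  apply Cmod_gt_0 in Hl. apply lt_INR in Hk. simpl in Hk.
  assert (Hp : 0 < INR k * Cmod l1) by nra.
  unfold wt. set (w := lat l1 l m) in *.
  match goal with |- Cmod ?x <= _ =>
    replace x with (/ ((u - w) * (u - w)) - / ((v - w) * (v - w)))%C by ring end.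
  eapply Rle_trans; [apply inv_sq_diff; lra|].
  assert (Hc : (3/4 * INR k * Cmod l1) ^ 3 <= Cmod w ^ 3) by (apply pow_incr; nra).
  assert (Hc0 : 0 < (3/4 * INR k * Cmod l1) ^ 3) by (apply pow_lt; nra).
  apply Rle_trans with (48 * Cmod (u - v) / (3/4 * INR k * Cmod l1) ^ 3).
  - unfold Rdiv. apply Rmult_le_compat_l; [pose proof (Cmod_ge_0 (u - v)); lra|].
    apply Rinv_le_contravar; auto.
  - pose proof (Cmod_ge_0 (u - v)).
    replace (48 * Cmod (u - v) / (3 / 4 * INR k * Cmod l1) ^ 3)
      with (Cmod (u - v) / (Cmod l1 ^ 3 * INR k ^ 3) * (48 * 64 / 27)) by (field; split; lra).
    replace (114 / Cmod l1 ^ 3 * Cmod (u - v) / INR k ^ 3)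
      with (Cmod (u - v) / (Cmod l1 ^ 3 * INR k ^ 3) * 114) by (field; split; lra).
    apply Rmult_le_compat_l; [|lra]. apply Rdiv_le_0_compat; auto.
    apply Rmult_lt_0_compat; apply pow_lt; auto.
Qed.

Lemma wt_at_0 l1 l m : wt l1 0 l m = 0.
Proof.
  unfold wt. replace ((0 - lat l1 l m) * (0 - lat l1 l m))%C with (lat l1 l m * lat l1 l m)%C by ring.
  ring.
Qed.

Lemma wt_decay (l1 z : C) l m (k : nat) : l1 <> RtoC 0 -> (0 < k)%nat ->
  (Z.of_nat k <= Z.abs l \/ Z.of_nat k <= Z.abs m)%Z ->
  Cmod z <= 3/8 * INR k * Cmod l1 ->
  Cmod (wt l1 z l m) <= 114 / Cmod l1 ^ 3 * Cmod z / INR k ^ 3.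
Proof.
  intros Hl Hk H Hz. pose proof (wt_diff l1 z 0 l m k Hl Hk H Hz) as HH.
  rewrite wt_at_0 in HH. replace (z - 0)%C with z in HH by ring.
  replace (wt l1 z l m - 0)%C with (wt l1 z l m) in HH by ring. apply HH.
  rewrite Cmod_0. pose proof (Cmod_ge_0 z). lra.
Qed.

Lemma exists_large (x y : R) : 0 < y -> exists N : nat, (0 < N)%nat /\ x < y * INR N.
Proof.
  intros Hy. destruct (nfloor_ex (Rmax 0 (x / y))) as [n [_ Hn]]; [apply Rmax_l|].
  exists (S n). split; [lia|]. rewrite S_INR.
  pose proof (Rmax_r 0 (x / y)).
  apply (Rmult_lt_reg_r (/ y)); [now apply Rinv_0_lt_compat|].
  replace (y * (INR n + 1) * / y) with (INR n + 1) by (field; lra). unfold Rdiv in *. lra.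
Qed.

Lemma clim_close_rate a b v c N0 :
  clim a v -> (forall N, (N0 <= N)%nat -> Cmod (b N - a N) <= c / INR N) -> clim b v.
Proof.
  intros Ha Hb. apply clim_close with a; auto. intros eps He.
  destruct (exists_large c eps He) as [N1 [HN1 H1]].
  exists (max N0 N1). intros N HN. eapply Rle_lt_trans; [apply Hb; lia|].
  assert (HN' : INR N1 <= INR N) by (apply le_INR; lia).
  assert (Hp : 0 < INR N) by (apply lt_0_INR; lia).
  apply (Rmult_lt_reg_r (INR N)); auto.
  replace (c / INR N * INR N) with c by (field; lra). nra.
Qed.

Ltac lia_div2 N :=
  let H := fresh in pose proof (Nat.div_mod_eq N 2) as H;
  pose proof (Nat.mod_upper_bound N 2 ltac:(discriminate));
  set (q_ := (N / 2)%nat) in *; set (r_ := (N mod 2)%nat) in *; clearbody q_ r_; lia.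

Lemma half_INR (N : nat) : (2 <= N)%nat -> INR N / 3 <= INR (N / 2).
Proof.
  intros H. assert (HH : (N <= 3 * (N / 2))%nat).
  { lia_div2 N. }
  apply le_INR in HH. rewrite mult_INR in HH. replace (INR 3) with 3 in HH by (simpl; lra). lra.
Qed.

Lemma in_lattice_lat (l1 z : C) : in_lattice l1 (Cmul omega l1) z <-> exists l m, z = lat l1 l m.
Proof. reflexivity. Qed.

(** * Rotation symmetry and periodicity *)

Lemma inv_omega_sq : (/ (omega * omega) = omega)%C.
Proof.
  assert (H : (omega * omega)%C <> 0).
  { intros H. pose proof omega_cube as E. rewrite H, Cmult_0_l in E. now apply C1_nz. }
  rewrite <- (Cmult_1_r (/ (omega * omega))), <- omega_cube. field.
  intros H'. apply omega_neq0. exact H'.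
Qed.

(** The terms are homogeneous of degree -2, and omega^(-2) = omega. *)
Lemma wt_omega l1 z l m : (wt l1 (omega * z) l m = omega * wt l1 z (m - l) (- l))%C.
Proof.
  unfold wt. rewrite <- (lat_omega l1 l m). set (w := lat l1 (m - l) (- l)).
  replace ((omega * z - omega * w) * (omega * z - omega * w))%C
    with ((omega * omega) * ((z - w) * (z - w)))%C by ring.
  replace (omega * w * (omega * w))%C with ((omega * omega) * (w * w))%C by ring.
  rewrite !(Cinv_mult_total (omega * omega)), inv_omega_sq. ring.
Qed.

(** The rotation carries the square to a parallelogram whose row l is a square row translated by l.
    About 2N rows exchange O(N) terms each; all of these terms are O(N^(-3)), so the discrepancy is
    O(1/N). *)
Lemma wp_at_omega (l1 z v : C) : l1 <> RtoC 0 ->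
  wp_at l1 (Cmul omega l1) z v -> wp_at l1 (Cmul omega l1) (omega * z)%C (omega * v)%C.
Proof.
  intros Hl. rewrite !wp_at_clim, !in_lattice_lat. intros [Hz Hv]. split.
  - intros (l & m & E). apply Hz. exists (m - l)%Z, (- l)%Z.
    rewrite <- (lat_omega l1 l m) in E.
    rewrite <- (Cmult_1_l z), <- omega_cube, <- (Cmult_1_l (lat l1 (m - l) (- l))), <- omega_cube.
    rewrite <- !Cmult_assoc, E. reflexivity.
  - set (D := 114 / Cmod l1 ^ 3 * Cmod z).
    assert (HD : 0 <= D).
    { unfold D. apply Rmult_le_pos; [|apply Cmod_ge_0].
      apply Rdiv_le_0_compat; [lra|]. apply pow_lt. now apply Cmod_gt_0. }
    destruct (exists_large (Cmod z) (1/8 * Cmod l1)) as [N0 [HN0 H0]].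
    { apply Cmod_gt_0 in Hl. lra. }
    (* 162 = 3 * 2 * 27: at most 3N rows, 2N exchanged terms per row, and 27 from replacing N/2 by
       the lower bound N/3. *)
    apply (clim_close_rate (fun N => omega * zsum2 (wt l1 z) N)%C _ _ (162 * D) (max 2 N0)).
    { now apply clim_scal. }
    intros N HN.
    rewrite (zsum2_ext (wt l1 (omega * z)) (fun l m => omega * wt l1 z (m - l)%Z (- l)%Z)%C)
      by (intros; apply wt_omega).
    rewrite zsum2_scal.
    set (f := wt l1 z).
    (* Row l of the rotated sum has second index -l, so the square sum is transposed and reflected
       to be compared with it row by row. *)
    replace (zsum2 f N) with (zsum (fun l => zsum (fun p => f p (- l)%Z) N) N).
    2:{ unfold zsum2. rewrite (zsum_swap f N N).
        apply (zsum_opp (fun m => zsum (fun l => f l m) N)). }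
    unfold zsum2.
    match goal with |- Cmod (omega * ?a - omega * ?b) <= _ =>
      replace (omega * a - omega * b)%C with (omega * (a - b))%C by ring end.
    rewrite Cmod_mult, Cmod_omega, Rmult_1_l, <- zsum_minus.
    assert (HNp : 2 <= INR N) by (apply (le_INR 2); lia).
    pose proof (half_INR N ltac:(lia)) as Hh.
    set (B := D / INR (N / 2) ^ 3).
    assert (HB : B <= 27 * D / INR N ^ 3).
    { replace (27 * D / INR N ^ 3) with (D / (INR N / 3) ^ 3) by (field; lra).
      unfold B, Rdiv. apply Rmult_le_compat_l; auto. apply Rinv_le_contravar.
      - apply pow_lt. lra.
      - apply pow_incr. lra. }
    apply Rle_trans with ((2 * INR N + 1) * (2 * INR N * B)).
    + apply zsum_bound. intros l Hlb.
      eapply Rle_trans.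
      * apply (zsum_shift_bound (fun p => f p (- l)%Z) N l B).
        (* From |p| > N - |l| it follows that |p| or |l| is at least N/2, so every exchanged term
           has cubic decay. *)
        intros p Hp. apply wt_decay; auto.
        -- apply (Nat.div_le_lower_bound N 2 1); lia.
        -- lia_div2 N.
        -- assert (INR N0 <= INR N) by (apply le_INR; lia). apply Cmod_gt_0 in Hl. nra.
      * assert (0 <= B).
        { unfold B. apply Rdiv_le_0_compat; auto. apply pow_lt. lra. }
        assert (IZR (Z.abs l) <= INR N) by (rewrite INR_IZR_INZ; now apply IZR_le).
        nra.
    + apply Rle_trans with (3 * INR N * (2 * INR N * (27 * D / INR N ^ 3))).
      * assert (0 <= 27 * D / INR N ^ 3).
        { apply Rdiv_le_0_compat; [lra|]. apply pow_lt. lra. }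
        assert (2 * INR N * B <= 2 * INR N * (27 * D / INR N ^ 3)) by nra.
        assert (0 <= 2 * INR N * (27 * D / INR N ^ 3)) by nra. nra.
      * right. field. lra.
Qed.

Lemma wp_at_omega_inv (l1 z v : C) : l1 <> RtoC 0 ->
  wp_at l1 (Cmul omega l1) (omega * z)%C (omega * v)%C -> wp_at l1 (Cmul omega l1) z v.
Proof.
  intros Hl H. apply wp_at_omega in H; auto. apply wp_at_omega in H; auto.
  assert (E : forall x : C, (omega * (omega * (omega * x)) = x)%C).
  { intros x. rewrite !Cmult_assoc, omega_cube. ring. }
  now rewrite !E in H.
Qed.

(** A translation along omega l1 shifts the inner index only. Each of the O(N) rows exchanges a
    fixed number of terms, and each such term is O(N^(-2)). *)
Lemma wp_at_shift_omega (l1 z v : C) (k : Z) : l1 <> RtoC 0 ->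
  wp_at l1 (Cmul omega l1) z v -> wp_at l1 (Cmul omega l1) (z + lat l1 0 k)%C v.
Proof.
  intros Hl. rewrite !wp_at_clim, !in_lattice_lat. intros [Hz Hv]. split.
  - intros (l & m & E). apply Hz. exists l, (m - k)%Z.
    replace z with (z + lat l1 0 k - lat l1 0 k)%C by ring. rewrite E.
    unfold lat. rewrite minus_IZR, RtoC_minus. ring.
  - apply Cmod_gt_0 in Hl.
    destruct (exists_large (Cmod z) (1/8 * Cmod l1)) as [N0 [HN0 H0]]; [lra|].
    apply (clim_close_rate (zsum2 (wt l1 z)) _ _ (384 * IZR (Z.abs k) / Cmod l1 ^ 2)
      (max 2 (max N0 (2 * Z.abs_nat k)))); auto.
    intros N HN.
    (* The subtracted constants 1/w^2 do not depend on z and cancel; only the part [a] is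
       shifted. *)
    set (a := fun z l m => (/ ((z - lat l1 l m) * (z - lat l1 l m)))%C).
    assert (Ea : forall z, zsum2 (wt l1 z) N
        = (zsum2 (a z) N - zsum2 (fun l m => / (lat l1 l m * lat l1 l m))%C N)%C).
    { intros z'. rewrite <- zsum2_minus. reflexivity. }
    rewrite !Ea.
    match goal with |- Cmod (?x - ?y - (?t - ?y)) <= _ =>
      replace (x - y - (t - y))%C with (x - t)%C by ring end.
    rewrite (zsum2_ext (a (z + lat l1 0 k)%C) (fun l m => a z l (m - k)%Z)).
    2:{ intros l m _ _. unfold a.
        replace (lat l1 l (m - k)) with (lat l1 l m - lat l1 0 k)%C.
        - do 2 f_equal; ring.
        - unfold lat. rewrite minus_IZR, RtoC_minus. ring. }
    unfold zsum2. rewrite <- zsum_minus.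
    assert (HNp : 2 <= INR N) by (apply (le_INR 2); lia).
    pose proof (half_INR N ltac:(lia)) as Hh.
    set (B := 64 / (Cmod l1 ^ 2 * INR N ^ 2)).
    assert (HB : 0 <= B).
    { unfold B. apply Rdiv_le_0_compat; [lra|].
      apply Rmult_lt_0_compat; apply pow_lt; lra. }
    assert (Hk0 : 0 <= IZR (Z.abs k)) by (apply (IZR_le 0); lia).
    apply Rle_trans with ((2 * INR N + 1) * (2 * IZR (Z.abs k) * B)).
    + apply zsum_bound. intros l Hlb.
      apply (zsum_shift_bound (a z l) N k B). intros p Hp. unfold a.
      assert (Hlow : 3/4 * INR (N / 2) * Cmod l1 <= Cmod (lat l1 l p)).
      { apply lat_lower. lia_div2 N. }
      assert (Hlow2 : 1/4 * (INR N * Cmod l1) <= Cmod (lat l1 l p)) by nra.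
      assert (Hpp : 0 < INR N * Cmod l1) by nra.
      assert (INR N0 <= INR N) by (apply le_INR; lia).
      eapply Rle_trans; [apply inv_sq_bound|].
      * lra.
      * nra.
      * replace B with (4 / (1/4 * (INR N * Cmod l1)) ^ 2) by (unfold B; field; lra).
        unfold Rdiv. apply Rmult_le_compat_l; [lra|]. apply Rinv_le_contravar.
        -- apply pow_lt. lra.
        -- apply pow_incr. lra.
    + apply Rle_trans with (3 * INR N * (2 * IZR (Z.abs k) * B)).
      * assert (0 <= 2 * IZR (Z.abs k) * B) by nra. nra.
      * right. unfold B. field. lra.
Qed.

(** Multiplication by omega turns a translation along l1 into one along omega l1, which is the case
    already treated. *)
Lemma wp_at_shift (l1 z v : C) (l m : Z) : l1 <> RtoC 0 ->
  wp_at l1 (Cmul omega l1) z v -> wp_at l1 (Cmul omega l1) (z + lat l1 l m)%C v.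
Proof.
  intros Hl H. rewrite <- (Z.add_0_l m), <- (Z.add_0_r l), <- lat_plus, Cplus_assoc.
  apply wp_at_shift_omega; auto. apply wp_at_omega_inv; auto.
  replace (omega * (z + lat l1 l 0))%C with (omega * z + lat l1 0 l)%C.
  - apply wp_at_shift_omega; auto. now apply wp_at_omega.
  - unfold lat. ring.
Qed.

(** * The regular part at the origin *)

Lemma wt0_diff (l1 u v : C) l m (k : nat) : l1 <> RtoC 0 -> (0 < k)%nat ->
  (Z.abs l = Z.of_nat k \/ Z.abs m = Z.of_nat k) ->
  Cmod u <= 3/8 * Cmod l1 -> Cmod v <= 3/8 * Cmod l1 ->
  Cmod (wt0 l1 u l m - wt0 l1 v l m) <= 114 / Cmod l1 ^ 3 * Cmod (u - v) / INR k ^ 3.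
Proof.
  intros Hl Hk H Hu Hv. unfold wt0.
  replace ((l =? 0)%Z && (m =? 0)%Z)%bool with false.
  2:{ symmetry. apply Bool.andb_false_iff. rewrite !Z.eqb_neq. lia. }
  assert (1 <= INR k) by (apply (le_INR 1); lia). pose proof (Cmod_ge_0 l1).
  apply wt_diff; auto; try lia; nra.
Qed.

(* The regular part of the Weierstrass function at the origin: wp(u) = 1/u^2 + wp_reg(u). *)
Definition wp_reg (l1 u : C) : C :=
  epsilon (inhabits (RtoC 0)) (clim (zsum2 (wt0 l1 u))).

Lemma wt0_at_0 l1 l m : wt0 l1 0 l m = 0.
Proof. unfold wt0. destruct (_ && _)%bool; auto. apply wt_at_0. Qed.

Lemma zsum2_zero N : zsum2 (fun _ _ => RtoC 0) N = 0.
Proof.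
  pose proof (zsum2_scal 0 (fun _ _ => RtoC 0) N) as H. rewrite Cmult_0_l in H.
  etransitivity; [|exact H]. apply zsum2_ext. intros. ring.
Qed.

Lemma wp_reg_clim (l1 u : C) : l1 <> RtoC 0 -> Cmod u <= 3/8 * Cmod l1 ->
  clim (zsum2 (wt0 l1 u)) (wp_reg l1 u).
Proof.
  intros Hl Hu. unfold wp_reg. apply epsilon_spec. apply clim_cauchy.
  set (A := 114 / Cmod l1 ^ 3 * Cmod u).
  assert (HA : 0 <= A).
  { unfold A. apply Rmult_le_pos; [|apply Cmod_ge_0].
    apply Rdiv_le_0_compat; [lra|]. apply pow_lt. now apply Cmod_gt_0. }
  assert (Ht : forall N p, Cmod (zsum2 (wt0 l1 u) (N + p) - zsum2 (wt0 l1 u) N)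
     <= 8 * A * (/ (INR N + 1/2) - / (INR (N + p) + 1/2))).
  { intros N p. apply (zsum2_tail (wt0 l1 u) A 0); auto; [|lia].
    intros l m k Hk H. pose proof (wt0_diff l1 u 0 l m k Hl Hk H Hu) as HH.
    rewrite wt0_at_0 in HH. replace (u - 0)%C with u in HH by ring.
    replace (wt0 l1 u l m - 0)%C with (wt0 l1 u l m) in HH by ring. apply HH.
    rewrite Cmod_0. pose proof (Cmod_ge_0 l1). lra. }
  intros eps He. destruct (exists_large (16 * A) eps He) as [N0 [HN0 H0]].
  exists N0.
  assert (Hpos : 0 < INR N0) by (apply lt_0_INR; lia).
  assert (Hb : forall p, (N0 <= p)%nat -> Cmod (zsum2 (wt0 l1 u) p - zsum2 (wt0 l1 u) N0) < eps / 2).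
  { intros p Hp. replace p with (N0 + (p - N0))%nat by lia.
    eapply Rle_lt_trans; [apply Ht|].
    apply Rle_lt_trans with (8 * A * / INR N0).
    - apply Rmult_le_compat_l; [lra|].
      assert (0 < / (INR (N0 + (p - N0)) + 1 / 2)).
      { apply Rinv_0_lt_compat. pose proof (pos_INR (N0 + (p - N0))). lra. }
      assert (/ (INR N0 + 1/2) <= / INR N0) by (apply Rinv_le_contravar; lra). lra.
    - apply (Rmult_lt_reg_r (INR N0)); auto. rewrite Rmult_assoc, Rinv_l; lra. }
  intros p q Hp Hq. specialize (Hb p Hp) as Hb1. specialize (Hb q Hq).
  eapply Rle_lt_trans; [apply (Cmod_triangle3 _ (zsum2 (wt0 l1 u) N0))|].
  rewrite (Cmod_minus_sym (zsum2 (wt0 l1 u) N0)). lra.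
Qed.

Lemma wp_reg_0 (l1 : C) : l1 <> RtoC 0 -> wp_reg l1 0 = 0.
Proof.
  intros Hl. apply (clim_unique (zsum2 (wt0 l1 0))).
  - apply wp_reg_clim; auto. rewrite Cmod_0. pose proof (Cmod_ge_0 l1). lra.
  - intros eps He. exists O. intros N _.
    rewrite (zsum2_ext _ (fun _ _ => RtoC 0)) by (intros; apply wt0_at_0).
    rewrite zsum2_zero. replace (0 - 0)%C with (RtoC 0) by ring. now rewrite Cmod_0.
Qed.

Lemma clim_dist_le a b v v' B : clim a v -> clim b v' ->
  (forall N, Cmod (a N - b N) <= B) -> Cmod (v - v') <= B.
Proof.
  intros Ha Hb H. apply Rnot_lt_le. intros Hn.
  set (e := (Cmod (v - v') - B) / 2). assert (He : 0 < e) by (unfold e; lra).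
  destruct (Ha e He) as [N1 H1]. destruct (Hb e He) as [N2 H2].
  specialize (H1 (max N1 N2) ltac:(lia)). specialize (H2 (max N1 N2) ltac:(lia)).
  specialize (H (max N1 N2)). set (N := max N1 N2) in *.
  pose proof (Cmod_triangle3 v (a N) v'). pose proof (Cmod_triangle3 (a N) (b N) v').
  rewrite (Cmod_minus_sym v (a N)) in H0. unfold e in *. lra.
Qed.

(** The termwise estimate passes to the limit; 1824 = 114 * 8 * 2, where 8 * 2 is the tail bound
    started at N = 0. *)
Lemma wp_reg_lip (l1 u v : C) : l1 <> RtoC 0 ->
  Cmod u <= 3/8 * Cmod l1 -> Cmod v <= 3/8 * Cmod l1 ->
  Cmod (wp_reg l1 u - wp_reg l1 v) <= 1824 / Cmod l1 ^ 3 * Cmod (u - v).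
Proof.
  intros Hl Hu Hv.
  apply (clim_dist_le (zsum2 (wt0 l1 u)) (zsum2 (wt0 l1 v))); try now apply wp_reg_clim.
  intros N. rewrite <- zsum2_minus.
  set (A := 114 / Cmod l1 ^ 3 * Cmod (u - v)).
  assert (HA : 0 <= A).
  { unfold A. apply Rmult_le_pos; [|apply Cmod_ge_0].
    apply Rdiv_le_0_compat; [lra|]. apply pow_lt. now apply Cmod_gt_0. }
  pose proof (zsum2_tail (fun l m => wt0 l1 u l m - wt0 l1 v l m)%C A 0) as Ht.
  specialize (Ht ltac:(intros; now apply wt0_diff) HA O (le_n _) N).
  replace (zsum2 (fun l m => wt0 l1 u l m - wt0 l1 v l m)%C 0) with (RtoC 0) in Ht
    by (unfold zsum2, wt0; simpl; ring).
  set (X := zsum2 _ _) in *. cbn [plus] in Ht. replace (X - 0)%C with X in Ht by ring.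
  eapply Rle_trans; [exact Ht|].
  replace (1824 / Cmod l1 ^ 3 * Cmod (u - v)) with (8 * A * 2) by (unfold A; field;
    apply Cmod_gt_0 in Hl; lra).
  apply Rmult_le_compat_l; [lra|].
  assert (0 < / (INR N + 1/2)).
  { apply Rinv_0_lt_compat. pose proof (pos_INR N). lra. }
  simpl. replace (/ (0 + 1/2)) with 2 by field. lra.
Qed.

Lemma wp_at_small (l1 u : C) : l1 <> RtoC 0 -> u <> RtoC 0 -> Cmod u <= 3/8 * Cmod l1 ->
  wp_at l1 (Cmul omega l1) u (/ (u * u) + wp_reg l1 u)%C.
Proof.
  intros Hl Hu0 Hu. rewrite wp_at_clim, in_lattice_lat. split.
  - intros (l & m & E). pose proof (lat_1_lower l1 l m) as H. apply Cmod_gt_0 in Hl.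
    rewrite <- E in H. destruct (Z.eq_dec l 0) as [->|Hl0].
    + destruct (Z.eq_dec m 0) as [->|Hm0].
      * apply Hu0. now rewrite E, lat_00.
      * specialize (H ltac:(congruence)). lra.
    + specialize (H ltac:(congruence)). lra.
  - intros eps He. destruct (wp_reg_clim l1 u Hl Hu eps He) as [N0 HN].
    exists N0. intros N H. specialize (HN N H). rewrite zsum2_wt.
    match goal with |- Cmod ?x < _ => replace x with (zsum2 (wt0 l1 u) N - wp_reg l1 u)%C by ring end.
    exact HN.
Qed.

(** * Infinite branches of finitely branching trees *)

Definition lsum {A} (l : list A) (g : A -> R) : R := fold_right (fun x acc => g x + acc) 0 l.

Definition ind (P : Prop) : R := if excluded_middle_informative P then 1 else 0.

Lemma ind_true (P : Prop) : P -> ind P = 1.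
Proof. intros H. unfold ind. destruct excluded_middle_informative; tauto. Qed.

Lemma ind_false (P : Prop) : ~ P -> ind P = 0.
Proof. intros H. unfold ind. destruct excluded_middle_informative; tauto. Qed.

Lemma ind_ge0 P : 0 <= ind P.
Proof. unfold ind. destruct excluded_middle_informative; lra. Qed.

Lemma ind_le1 P : ind P <= 1.
Proof. unfold ind. destruct excluded_middle_informative; lra. Qed.

Lemma ind_mono (P Q : Prop) : (P -> Q) -> ind P <= ind Q.
Proof. intros H. unfold ind. do 2 destruct excluded_middle_informative; try lra; tauto. Qed.

Section lsum.
Context {A : Type}.

Lemma lsum_le (l : list A) g h : (forall x, In x l -> g x <= h x) -> lsum l g <= lsum l h.
Proof.
  induction l as [|a l IH]; intros H; simpl; [lra|].
  apply Rplus_le_compat; [apply H; now left|apply IH; intros; apply H; now right].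
Qed.

Lemma lsum_scal (l : list A) c g : lsum l (fun x => c * g x) = c * lsum l g.
Proof. induction l as [|a l IH]; simpl; [|rewrite IH]; ring. Qed.

Lemma lsum_plus (l : list A) g h : lsum l (fun x => g x + h x) = lsum l g + lsum l h.
Proof. induction l as [|a l IH]; simpl; [|rewrite IH]; ring. Qed.

Lemma scal_sum_l c (f : nat -> R) K :
  c * sum_f_R0 f K = sum_f_R0 (fun k => c * f k) K.
Proof. induction K as [|K IH]; simpl; [|rewrite <- IH]; ring. Qed.

Lemma lsum_const (l : list A) c : lsum l (fun _ => c) = INR (length l) * c.
Proof. induction l as [|a l IH]; [simpl; ring|]. cbn [lsum fold_right length] in *.
  unfold lsum in IH. rewrite IH, S_INR. ring. Qed.

Lemma lsum_sum_f_R0 (l : list A) (g : nat -> A -> R) K :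
  lsum l (fun x => sum_f_R0 (fun k => g k x) K) = sum_f_R0 (fun k => lsum l (g k)) K.
Proof. induction K as [|K IH]; simpl; auto. rewrite lsum_plus, IH. reflexivity. Qed.

Lemma lsum_eq_le1 (l : list A) a : NoDup l -> lsum l (fun x => ind (x = a)) <= 1.
Proof.
  induction l as [|b l IH]; intros H; [simpl; lra|].
  inversion H as [|? ? Hb Hl]; subst. change (ind (b = a) + lsum l (fun x => ind (x = a)) <= 1).
  destruct (classic (b = a)) as [->|Hba].
  - rewrite ind_true by auto.
    assert (lsum l (fun x => ind (x = a)) <= lsum l (fun _ => 0)).
    { apply lsum_le. intros x Hx. rewrite ind_false; [lra|]. intros ->. contradiction. }
    rewrite lsum_const in H0. lra.
  - rewrite ind_false by auto. specialize (IH Hl). lra.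
Qed.

(** Otherwise each letter exceeds [th] from some K on; by monotonicity one K serves the whole finite
    list, and the average at that K is too large. *)
Lemma lsum_pigeonhole (l : list A) (g : nat -> A -> R) th :
  l <> nil -> (forall K x, g K x <= g (S K) x) ->
  (forall K, lsum l (g K) <= INR (length l) * th) ->
  exists x, In x l /\ forall K, g K x <= th.
Proof.
  intros Hl Hm Hs. apply NNPP. intros Hn.
  assert (Hmono : forall K K' x, (K <= K')%nat -> g K x <= g K' x).
  { intros K K' x HK. induction HK; [lra|]. eapply Rle_trans; [eassumption|apply Hm]. }
  assert (Hx : forall l', (forall x, In x l' -> In x l) ->
            exists K, forall x, In x l' -> th < g K x).
  { induction l' as [|a l' IH]; intros Hi.
    - exists O. intros x [].
    - destruct IH as [K1 H1]; [intros; apply Hi; now right|].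
      assert (exists K, th < g K a) as [K2 H2].
      { apply NNPP. intros Hc. apply Hn. exists a. split; [apply Hi; now left|].
        intros K. apply Rnot_lt_le. intros Hc'. apply Hc. now exists K. }
      exists (max K1 K2). intros x [<-|Hx].
      + apply Rlt_le_trans with (g K2 a); [exact H2|apply Hmono; lia].
      + apply Rlt_le_trans with (g K1 x); [exact (H1 x Hx)|apply Hmono; lia]. }
  destruct (Hx l) as [K HK]; auto.
  specialize (Hs K).
  assert (Hgt : INR (length l) * th < lsum l (g K)).
  { clear Hs Hx Hn. destruct l as [|a l]; [congruence|].
    cbn [lsum fold_right length]. rewrite S_INR.
    assert (th < g K a) by (apply HK; now left).
    assert (INR (length l) * th <= lsum l (g K)).
    { rewrite <- lsum_const. apply lsum_le. intros x Hx. left. apply HK. now right. }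
    unfold lsum in *. lra. }
  lra.
Qed.
End lsum.

(** * Avoiding countably many events of small total probability *)

Fixpoint prodn (N : nat -> R) (n : nat) : R :=
  match n with O => 1 | S k => prodn N k * N k end.

Lemma prodn_pos N n : (forall k, 0 < N k) -> 0 < prodn N n.
Proof. intros H. induction n; simpl; [lra|]. apply Rmult_lt_0_compat; auto. Qed.

Definition upd {A} (w : nat -> A) (n : nat) (x : A) : nat -> A :=
  fun j => if Nat.eqb j n then x else w j.

Section Avoid.
Context {A : Type} (alph : nat -> list A) (lev : nat -> nat) (p : nat -> nat -> A)
  (S_ : nat -> A -> Prop) (m : nat -> R).
Hypothesis alph_nonempty : forall n, alph n <> nil.
Hypothesis alph_nodup : forall n, NoDup (alph n).
Let N n := INR (length (alph n)).
Hypothesis m_ge0 : forall k, 0 <= m k.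
Hypothesis m_count :
  forall k, lsum (alph (lev k)) (fun x => ind (S_ k x)) <= m k * prodn N (S (lev k)).
Hypothesis m_sum : forall K, sum_f_R0 m K <= 1/2.

(** For independent uniform letters this event has probability |[S_ k]| / (N 0 ... N ([lev k])),
    which [m_count] bounds by [m k]. *)
Definition killed k (w : nat -> A) : Prop :=
  (forall j, (j < lev k)%nat -> w j = p k j) /\ S_ k (w (lev k)).

(* Conditional probability that a random continuation of the first [n] letters of [w] is
   killed by [k]. *)
Definition load k n (w : nat -> A) : R :=
  if le_dec n (lev k)
  then ind (forall j, (j < n)%nat -> w j = p k j) * (m k * prodn N n)
  else ind (killed k w).

Lemma N_pos n : 0 < N n.
Proof.
  unfold N. apply lt_0_INR. specialize (alph_nonempty n). destruct (alph n); simpl; [congruence|lia].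
Qed.

Lemma load_ge0 k n w : 0 <= load k n w.
Proof.
  unfold load. destruct le_dec; [|apply ind_ge0].
  apply Rmult_le_pos; [apply ind_ge0|]. apply Rmult_le_pos; auto.
  left. apply prodn_pos, N_pos.
Qed.

(** The load is a supermartingale. Below [lev k] only the letter [p k n] keeps the prefix alive, at
    [lev k] the count of [S_ k] applies, and above it the event is already decided. *)
Lemma load_average k n w :
  lsum (alph n) (fun x => load k (S n) (upd w n x)) <= N n * load k n w.
Proof.
  assert (Hup : forall x j, (j < n)%nat -> upd w n x j = w j).
  { intros x j Hj. unfold upd. destruct (Nat.eqb_spec j n); [lia|auto]. }
  assert (Hun : forall x, upd w n x n = x).
  { intros x. unfold upd. now rewrite Nat.eqb_refl. }
  set (P := forall j, (j < n)%nat -> w j = p k j).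
  destruct (lt_eq_lt_dec n (lev k)) as [[Hn|Hn]|Hn].
  - unfold load. destruct (le_dec n (lev k)); [|lia]. destruct (le_dec (S n) (lev k)); [|lia].
    fold P.
    eapply Rle_trans.
    + apply lsum_le with (h := fun x => ind P * (m k * prodn N (S n)) * ind (x = p k n)).
      intros x Hx. pose proof (prodn_pos N (S n) N_pos). pose proof (m_ge0 k).
      assert (0 <= m k * prodn N (S n)) by nra.
      destruct (classic P) as [HP|HP].
      * rewrite (ind_true P HP), Rmult_1_l, (Rmult_comm (ind _)).
        apply Rmult_le_compat_l; auto. apply ind_mono. intros Ha.
        rewrite <- (Hun x). apply Ha. lia.
      * rewrite (ind_false P HP), ind_false; [lra|]. intros Ha. apply HP.
        intros j Hj. rewrite <- (Hup x j Hj). apply Ha. lia.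
    + rewrite lsum_scal. simpl prodn.
      pose proof (lsum_eq_le1 (alph n) (p k n) (alph_nodup n)).
      pose proof (ind_ge0 P). pose proof (prodn_pos N n N_pos). pose proof (N_pos n).
      pose proof (m_ge0 k).
      assert (0 <= ind P * (m k * (prodn N n * N n))) by (repeat apply Rmult_le_pos; lra).
      replace (N n * (ind P * (m k * prodn N n))) with (ind P * (m k * (prodn N n * N n)) * 1) by ring.
      apply Rmult_le_compat_l; auto.
  - subst n. unfold load. destruct (le_dec (lev k) (lev k)); [|lia].
    destruct (le_dec (S (lev k)) (lev k)); [lia|]. fold P.
    eapply Rle_trans.
    + apply lsum_le with (h := fun x => ind P * ind (S_ k x)).
      intros x Hx. destruct (classic P) as [HP|HP].
      * rewrite (ind_true P HP), Rmult_1_l. apply ind_mono. intros [_ Ha].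
        now rewrite Hun in Ha.
      * rewrite (ind_false P HP), ind_false; [lra|]. intros [Ha _]. apply HP.
        intros j Hj. rewrite <- (Hup x j Hj). auto.
    + rewrite lsum_scal. pose proof (m_count k) as Hc. simpl prodn in Hc.
      replace (N (lev k) * (ind P * (m k * prodn N (lev k))))
        with (ind P * (m k * (prodn N (lev k) * N (lev k)))) by ring.
      apply Rmult_le_compat_l; auto. apply ind_ge0.
  - unfold load. destruct (le_dec n (lev k)); [lia|]. destruct (le_dec (S n) (lev k)); [lia|].
    unfold N. rewrite <- lsum_const. apply lsum_le. intros x Hx. apply ind_mono.
    intros [H1 H2]. split.
    + intros j Hj. rewrite <- (Hup x j); [auto|lia].
    + now rewrite Hup in H2 by lia.
Qed.

(** A completed kill has load 1, so keeping every partial sum of loads at most 1/2 rules it out. *)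
Let Good n w := forall K, sum_f_R0 (fun k => load k n w) K <= 1/2.

Lemma good_start w : Good O w.
Proof.
  intros K. eapply Rle_trans; [|apply (m_sum K)]. apply sum_Rle. intros k _.
  unfold load. destruct le_dec; [|lia]. simpl. pose proof (m_ge0 k).
  pose proof (ind_le1 (forall j, (j < 0)%nat -> w j = p k j)). nra.
Qed.

Lemma good_step n w : Good n w -> exists x, In x (alph n) /\ Good (S n) (upd w n x).
Proof.
  intros HG.
  destruct (lsum_pigeonhole (alph n)
     (fun K x => sum_f_R0 (fun k => load k (S n) (upd w n x)) K) (1/2)) as [x [Hx1 Hx2]]; auto.
  - intros K x. simpl. pose proof (load_ge0 (S K) (S n) (upd w n x)). lra.
  - intros K. rewrite (lsum_sum_f_R0 (alph n) (fun k x => load k (S n) (upd w n x))).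
    eapply Rle_trans.
    + apply sum_Rle with (Bn := fun k => load k n w * N n).
      intros k _. rewrite Rmult_comm. apply load_average.
    + rewrite <- scal_sum. apply Rmult_le_compat_l; [left; apply N_pos|apply HG].
  - exists x. auto.
Qed.

Lemma avoid_killed :
  exists w, (forall n, In (w n) (alph n)) /\ forall k, ~ killed k w.
Proof.
  assert (w0 : nat -> A).
  { intros n. specialize (alph_nonempty n). destruct (alph n) as [|a l]; [congruence|exact a]. }
  pose (step := fun n w => epsilon (inhabits (w0 O)) (fun x => In x (alph n) /\ Good (S n) (upd w n x))).
  pose (W := fix W n := match n with O => w0 | S n' => upd (W n') n' (step n' (W n')) end).
  assert (HW : forall n, Good n (W n)).
  { induction n as [|n IH]; [apply good_start|].
    destruct (epsilon_spec (inhabits (w0 O)) _ (good_step n (W n) IH)) as [_ H]. exact H. }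
  assert (Hin : forall n, In (W (S n) n) (alph n)).
  { intros n. destruct (epsilon_spec (inhabits (w0 O)) _ (good_step n (W n) (HW n))) as [H _].
    simpl. unfold upd. rewrite Nat.eqb_refl. exact H. }
  assert (Hst : forall d n, W (S n + d)%nat n = W (S n) n).
  { induction d as [|d IH]; intros n; [now rewrite Nat.add_0_r|].
    rewrite <- IH. rewrite Nat.add_succ_r. cbn [W]. unfold upd at 1.
    destruct (Nat.eqb_spec n (S n + d)); [lia|auto]. }
  exists (fun n => W (S n) n). split; auto.
  intros k [H1 H2].
  assert (Hk : killed k (W (S (lev k)))).
  { split; auto. intros j Hj. rewrite <- H1 by auto.
    replace (S (lev k)) with (S j + (lev k - j))%nat by lia. apply Hst. }
  pose proof (HW (S (lev k)) k) as HG.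
  assert (Hl : load k (S (lev k)) (W (S (lev k))) = 1).
  { unfold load. destruct le_dec; [lia|]. now apply ind_true. }
  destruct k as [|k]; cbn [sum_f_R0] in HG.
  - lra.
  - assert (0 <= sum_f_R0 (fun k0 => load k0 (S (lev (S k))) (W (S (lev (S k))))) k).
    { apply cond_pos_sum. intros. apply load_ge0. }
    lra.
Qed.
End Avoid.

(** * A lower bound for Hausdorff dimension *)

Definition square (M : nat) : list (nat * nat) := list_prod (seq 0 M) (seq 0 M).

Lemma lsum_app {A} (l l' : list A) g : lsum (l ++ l') g = lsum l g + lsum l' g.
Proof. unfold lsum. induction l as [|a l IH]; simpl; [ring|]. rewrite IH. ring. Qed.

Lemma lsum_map {A B} (f : A -> B) l g : lsum (map f l) g = lsum l (fun x => g (f x)).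
Proof. unfold lsum. induction l as [|a l IH]; simpl; [auto|]. now rewrite IH. Qed.

Lemma lsum_list_prod {A B} (l : list A) (l' : list B) g h :
  lsum (list_prod l l') (fun x => g (fst x) * h (snd x)) = lsum l g * lsum l' h.
Proof.
  induction l as [|a l IH]; [unfold lsum; simpl; ring|].
  simpl list_prod. rewrite lsum_app, IH, lsum_map. cbn [fst snd].
  rewrite lsum_scal. unfold lsum at 4. simpl. fold (lsum l g). ring.
Qed.

(** With T the integer part of t, at most 2T + 1 integers are in reach, and 2t + 1 <= 3t since t >=
    1. The start of the range is generalised so that the induction can shorten it. *)
Lemma count_near M a t : 1 <= t ->
  lsum (seq 0 M) (fun x => ind (Rabs (INR x - INR a) <= t)) <= 3 * t.
Proof.
  intros Ht.
  destruct (nfloor_ex t) as [T [HT1 HT2]]; [lra|].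
  assert (HT : forall s n, lsum (seq s n) (fun x => ind (Rabs (INR x - INR a) <= t))
               <= INR (a + T + 1 - max s (a - T))).
  { intros s n. revert s. induction n as [|n IH]; intros s.
    - unfold lsum. simpl. apply pos_INR.
    - cbn [seq lsum fold_right]. specialize (IH (S s)). unfold lsum in IH.
      destruct (classic (Rabs (INR s - INR a) <= t)) as [Hs|Hs].
      + rewrite ind_true by auto.
        assert (Hs1 : (s < a + T + 1)%nat).
        { apply INR_lt. rewrite !plus_INR. simpl. apply Rabs_le_between in Hs. lra. }
        assert (Hs2 : (a < s + T + 1)%nat).
        { apply INR_lt. rewrite !plus_INR. simpl. apply Rabs_le_between in Hs. lra. }
        replace (a + T + 1 - Nat.max s (a - T))%nat
          with (S (a + T + 1 - Nat.max (S s) (a - T))) by lia.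
        rewrite S_INR. lra.
      + rewrite ind_false by auto.
        assert (INR (a + T + 1 - Nat.max (S s) (a - T)) <= INR (a + T + 1 - Nat.max s (a - T)))
          by (apply le_INR; lia).
        lra. }
  eapply Rle_trans; [apply HT|].
  apply Rle_trans with (INR (T + T + 1)); [apply le_INR; lia|].
  rewrite !plus_INR. simpl. lra.
Qed.

Lemma count_near_square M a t : 1 <= t ->
  lsum (square M) (fun x => ind (Rabs (INR (fst x) - INR (fst a)) <= t /\
                                Rabs (INR (snd x) - INR (snd a)) <= t)) <= 9 * t ^ 2.
Proof.
  intros Ht.
  apply Rle_trans with (lsum (square M) (fun x =>
     (fun y => ind (Rabs (INR y - INR (fst a)) <= t)) (fst x) *
     (fun y => ind (Rabs (INR y - INR (snd a)) <= t)) (snd x))).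
  - apply lsum_le. intros [x y] _. simpl.
    destruct (classic (Rabs (INR x - INR (fst a)) <= t)) as [H1|H1];
    destruct (classic (Rabs (INR y - INR (snd a)) <= t)) as [H2|H2];
    unfold ind; repeat destruct excluded_middle_informative; try lra; tauto.
  - unfold square. rewrite (lsum_list_prod (seq 0 M) (seq 0 M)
      (fun y => ind (Rabs (INR y - INR (fst a)) <= t))
      (fun y => ind (Rabs (INR y - INR (snd a)) <= t))).
    pose proof (count_near M (fst a) t Ht). pose proof (count_near M (snd a) t Ht).
    assert (forall b, 0 <= lsum (seq 0 M) (fun y => ind (Rabs (INR y - INR b) <= t))).
    { intros b. pose proof (lsum_const (seq 0 M) 0) as H1. rewrite Rmult_0_r in H1. rewrite <- H1.
      apply lsum_le. intros; apply ind_ge0. }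
    replace (9 * t ^ 2) with ((3 * t) * (3 * t)) by ring.
    apply Rmult_le_compat; auto.
Qed.

Lemma NoDup_list_prod {A B} (l : list A) (l' : list B) :
  NoDup l -> NoDup l' -> NoDup (list_prod l l').
Proof.
  intros Hl Hl'. induction Hl as [|a l Ha Hl IH]; simpl; [constructor|].
  apply NoDup_app; auto.
  - apply Injective_map_NoDup; [intros x y H; now inversion H|auto].
  - intros [x y] Hx Hy. apply in_map_iff in Hx. destruct Hx as (z & Hz & _).
    inversion Hz; subst. apply in_prod_iff in Hy. tauto.
Qed.

Lemma NoDup_square M : NoDup (square M).
Proof. apply NoDup_list_prod; apply seq_NoDup. Qed.

Lemma length_square M : INR (length (square M)) = INR M ^ 2.
Proof. unfold square. rewrite length_prod, length_seq, mult_INR. ring. Qed.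

(** This is min(x^2, y^2) <= x^s y^(2 - s). It merges two counts of the letters met by a set of the
    cover, the area bound and the size of the whole alphabet, into one bound proportional to r^s. *)
Lemma Rpower_interpolate x y z s : 0 < x -> 0 < y -> 0 <= s <= 2 -> z <= x ^ 2 -> z <= y ^ 2 ->
  z <= Rpower x s * Rpower y (2 - s).
Proof.
  intros Hx Hy Hs Hzx Hzy.
  assert (E : forall x, 0 < x -> x ^ 2 = Rpower x s * Rpower x (2 - s)).
  { intros u Hu. rewrite <- Rpower_plus. replace (s + (2 - s)) with (INR 2) by (simpl; lra).
    now rewrite Rpower_pow. }
  destruct (Rle_dec x y) as [H|H].
  - eapply Rle_trans; [exact Hzx|]. rewrite (E x Hx).
    apply Rmult_le_compat_l; [left; apply exp_pos|]. apply Rle_Rpower_l; lra.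
  - eapply Rle_trans; [exact Hzy|]. rewrite (E y Hy).
    apply Rmult_le_compat_r; [left; apply exp_pos|]. apply Rle_Rpower_l; lra.
Qed.


Section Dimension.
Variables (phi : (nat -> nat * nat) -> C) (M : nat -> nat) (dl : nat -> R) (s c0 : R)
  (E : Cplx -> Prop).
Definition letters (w : nat -> nat * nat) := forall n, In (w n) (square (M n)).
Hypothesis M_pos : forall n, (0 < M n)%nat.
Hypothesis dl_pos : forall n, 0 < dl n.
Hypothesis dl_decr : forall n, dl (S n) <= dl n.
Hypothesis dl_lim : forall r, 0 < r -> exists n, dl n <= r.
Hypothesis s_range : 0 < s <= 2.
Hypothesis phi_E : forall w, letters w -> E (phi w).
Hypothesis phi_sep : forall w w' n, letters w -> letters w' ->
  (forall j, (j < n)%nat -> w j = w' j) ->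
  dl n * Rabs (INR (fst (w n)) - INR (fst (w' n))) <= Cmod (phi w - phi w') /\
  dl n * Rabs (INR (snd (w n)) - INR (snd (w' n))) <= Cmod (phi w - phi w').
Hypothesis c0_pos : 0 < c0.
Hypothesis mass : forall n,
  c0 <= Rpower (dl n * INR (M n)) s * prodn (fun k => INR (M k) ^ 2) n.

Lemma dl_mono n k : (n <= k)%nat -> dl k <= dl n.
Proof. intros H. induction H; [lra|]. eapply Rle_trans; [apply dl_decr|auto]. Qed.

Lemma level_exists r : 0 < r -> r < dl 0 -> exists n, dl (S n) <= r < dl n.
Proof.
  intros Hr H0. destruct (dl_lim r Hr) as [k Hk].
  induction k as [|k IH]; [lra|].
  destruct (Rle_dec (dl k) r); [auto|]. exists k. lra.
Qed.

Lemma INR_neq_dist a b : a <> b -> 1 <= Rabs (INR a - INR b).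
Proof.
  intros H. rewrite !INR_IZR_INZ, <- minus_IZR, <- abs_IZR. apply IZR_le. lia.
Qed.

(** A first difference at j <= n is an integer difference of at least 1 in some coordinate, which
    separates the images by [dl j] >= [dl n] > r. *)
Lemma close_same_prefix w w' n r : letters w -> letters w' ->
  Cmod (phi w - phi w') <= r -> r < dl n ->
  forall j, (j <= n)%nat -> w j = w' j.
Proof.
  intros Hw Hw' Hd Hr j. induction j as [j IH] using lt_wf_ind. intros Hj.
  destruct (phi_sep w w' j Hw Hw') as [H1 H2]; [intros; apply IH; lia|].
  pose proof (dl_mono j n Hj) as Hm. pose proof (dl_pos j).
  apply injective_projections.
  - destruct (Nat.eq_dec (fst (w j)) (fst (w' j))) as [|Hne]; auto.
    pose proof (INR_neq_dist _ _ Hne). nra.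
  - destruct (Nat.eq_dec (snd (w j)) (snd (w' j))) as [|Hne]; auto.
    pose proof (INR_neq_dist _ _ Hne). nra.
Qed.

(** A mass distribution argument. [prodn] counts the cylinders of length n, and [dl n * INR (M n)]
    is the scale on which the next letter spreads each of them out, so [mass] bounds their
    s-dimensional content from below. *)
Lemma not_hausdorff_null : ~ hausdorff_null s E.
Proof.
  intros HN.
  assert (H3 : 0 < Rpower 3 s) by apply exp_pos.
  (* Radii below [dl 0] have a level, and the bound on the sum makes the killed proportions [m] add
     up to at most 1/2. *)
  destruct (HN (dl 0 / 2) (c0 / (2 * Rpower 3 s))) as (U & r & Hr & HU & Hcov & Hsum).
  { pose proof (dl_pos 0). lra. }
  { apply Rdiv_lt_0_compat; lra. }
  assert (Hlev : forall k, exists n, dl (S n) <= r k < dl n).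
  { intros k. apply level_exists; pose proof (Hr k); pose proof (dl_pos 0); lra. }
  apply choice in Hlev. destruct Hlev as [lv Hlv].
  (* [p k] is a reference word with image in U k. If U k contains no image of a word, the constant
     word is a default about which nothing is claimed. *)
  assert (Hp : forall k, exists p, forall w, letters w -> U k (phi w) -> letters p /\ U k (phi p)).
  { intros k. destruct (classic (exists w, letters w /\ U k (phi w))) as [[w Hw]|Hn].
    - exists w. auto.
    - exists (fun _ => (0, 0)%nat). intros w H1 H2. exfalso. apply Hn. now exists w. }
  apply choice in Hp. destruct Hp as [p Hp].
  (* A set of diameter r k fixes the letters up to [lv k]; at the next level its letters differ by
     at most [t k] in each coordinate. *)
  pose (t := fun k => r k / dl (S (lv k))).
  assert (Ht : forall k, 1 <= t k).
  { intros k. unfold t. apply (Rmult_le_reg_r (dl (S (lv k)))); [apply dl_pos|].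
    unfold Rdiv. rewrite Rmult_assoc, Rinv_l by (apply Rgt_not_eq, dl_pos).
    destruct (Hlv k). lra. }
  pose (m := fun k => Rpower 3 s / c0 * Rpower (r k) s).
  assert (Hm0 : forall k, 0 <= m k).
  { intros k. unfold m. left. apply Rmult_lt_0_compat; [apply Rdiv_lt_0_compat; lra|apply exp_pos]. }
  destruct (avoid_killed (fun n => square (M n)) (fun k => S (lv k)) p
    (fun k x => Rabs (INR (fst x) - INR (fst (p k (S (lv k))))) <= t k /\
                Rabs (INR (snd x) - INR (snd (p k (S (lv k))))) <= t k) m) as [w [Hw1 Hw2]].
  - intros n Hn. pose proof (length_square (M n)) as Hl. rewrite Hn in Hl. simpl in Hl.
    pose proof (lt_0_INR _ (M_pos n)). nra.
  - intros n. apply NoDup_square.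
  - exact Hm0.
  - intros k. set (n := S (lv k)).
    set (X := lsum _ _).
    assert (HX1 : X <= (3 * t k) ^ 2).
    { unfold X. eapply Rle_trans; [apply count_near_square, Ht|]. lra. }
    assert (HMn : 0 < INR (M n)) by (apply lt_0_INR, M_pos).
    assert (HX2 : X <= INR (M n) ^ 2).
    { rewrite <- length_square. unfold X. rewrite <- (Rmult_1_r (INR (length _))), <- lsum_const.
      apply lsum_le. intros; apply ind_le1. }
    assert (HX : X <= Rpower (3 * t k) s * Rpower (INR (M n)) (2 - s)).
    { apply Rpower_interpolate; auto; pose proof (Ht k); lra. }
    eapply Rle_trans; [exact HX|].
    cbn [prodn]. rewrite length_square.
    replace (prodn (fun n0 => INR (length (square (M n0)))) n)
      with (prodn (fun k => INR (M k) ^ 2) n)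
      by (clear; induction n as [|n IH]; cbn [prodn]; [|rewrite IH, length_square]; auto).
    set (P := prodn _ n). specialize (mass n). fold P in mass.
    pose proof (dl_pos n) as Hd.
    assert (Hrk : 0 < r k) by apply Hr.
    rewrite <- Rpower_mult_distr in mass by assumption.
    replace (Rpower (3 * t k) s) with (Rpower 3 s * (Rpower (r k) s * / Rpower (dl n) s)).
    2:{ assert (Ht' : r k = t k * dl n) by (unfold t; fold n; field; lra).
        rewrite Ht' at 1. pose proof (Ht k).
        rewrite <- !Rpower_mult_distr by lra. field. apply Rgt_not_eq, exp_pos. }
    replace (Rpower (INR (M n)) (2 - s)) with (INR (M n) ^ 2 * / Rpower (INR (M n)) s).
    2:{ unfold Rminus. rewrite Rpower_plus, Rpower_Ropp. f_equal.
        replace 2 with (INR 2) by (simpl; lra). now rewrite Rpower_pow. }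
    unfold m.
    assert (Ha : 0 < Rpower (r k) s) by apply exp_pos.
    assert (Hb : 0 < Rpower (dl n) s) by apply exp_pos.
    assert (He : 0 < Rpower (INR (M n)) s) by apply exp_pos.
    set (a := Rpower (r k) s) in *. set (b := Rpower (dl n) s) in *.
    set (e := Rpower (INR (M n)) s) in *. set (T := Rpower 3 s) in *.
    assert (HP : / (b * e) <= P / c0).
    { apply (Rmult_le_reg_r (b * e * c0)); [repeat apply Rmult_lt_0_compat; auto|].
      replace (/ (b * e) * (b * e * c0)) with c0 by (field; lra).
      replace (P / c0 * (b * e * c0)) with (b * e * P) by (field; lra). exact mass. }
    replace (T * (a * / b) * (INR (M n) ^ 2 * / e)) with (T * a * INR (M n) ^ 2 * / (b * e))
      by (field; lra).
    replace (T / c0 * a * (P * INR (M n) ^ 2)) with (T * a * INR (M n) ^ 2 * (P / c0))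
      by (field; lra).
    apply Rmult_le_compat_l; auto. pose proof (pow_lt _ 2 HMn).
    left. repeat apply Rmult_lt_0_compat; auto; lra.
  - intros K. unfold m. rewrite <- scal_sum_l.
    specialize (Hsum K).
    apply Rle_trans with (Rpower 3 s / c0 * (c0 / (2 * Rpower 3 s))).
    + apply Rmult_le_compat_l; auto. left. apply Rdiv_lt_0_compat; lra.
    + right. field. lra.
  - destruct (Hcov _ (phi_E w Hw1)) as [k Hk].
    destruct (Hp k w Hw1 Hk) as [Hp1 Hp2].
    assert (Hd : Cmod (phi w - phi (p k)) <= r k).
    { specialize (HU k _ _ Hk Hp2). rewrite Cabs_Cmod in HU. exact HU. }
    destruct (Hlv k) as [Hl1 Hl2].
    assert (Hpre : forall j, (j <= lv k)%nat -> w j = p k j)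
      by (apply close_same_prefix with (r k); auto).
    apply (Hw2 k). split.
    + intros j Hj. apply Hpre. lia.
    + destruct (phi_sep w (p k) (S (lv k))) as [H1 H2]; auto.
      { intros j Hj. apply Hpre. lia. }
      unfold t. pose proof (dl_pos (S (lv k))).
      split; apply (Rmult_le_reg_l (dl (S (lv k)))); auto; unfold Rdiv;
        rewrite (Rmult_comm (r k)), <- Rmult_assoc, Rinv_r, Rmult_1_l; lra.
Qed.
End Dimension.

(** * The critical values are nonzero *)

Lemma wt_scale (l1 x : C) l m : (wt l1 (x * l1) l m = / (l1 * l1) * wt 1 x l m)%C.
Proof.
  unfold wt. rewrite (lat_eq l1), (lat_eq 1), Cmult_1_r.
  set (w := (IZR l + IZR m * omega)%C).
  replace ((x * l1 - w * l1) * (x * l1 - w * l1))%C with ((l1 * l1) * ((x - w) * (x - w)))%C by ring.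
  replace (w * l1 * (w * l1))%C with ((l1 * l1) * (w * w))%C by ring.
  rewrite !(Cinv_mult_total (l1 * l1)). ring.
Qed.

(** The real part of 1/(x + i y sqrt 3)^2. Taking sqrt 3 out of the imaginary part makes the central
    terms of the series rational. *)
Definition rho (x y : R) : R := (x ^ 2 - 3 * y ^ 2) / (x ^ 2 + 3 * y ^ 2) ^ 2.

Lemma Re_inv_sq (x y : R) : x ^ 2 + 3 * y ^ 2 <> 0 ->
  Re (/ ((x, y * sqrt 3)%R * (x, y * sqrt 3)%R))%C = rho x y.
Proof.
  intros H. rewrite Cinv_mult_total. unfold rho, Complex.Cinv, Cmult, Re. simpl.
  assert (E : sqrt 3 * sqrt 3 = 3) by (apply sqrt_sqrt; lra).
  replace (x * (x * 1) + y * sqrt 3 * (y * sqrt 3 * 1)) with (x ^ 2 + 3 * y ^ 2) by nra.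
  apply (Rmult_eq_reg_r ((x ^ 2 + 3 * y ^ 2) ^ 2)); [|now apply pow_nonzero].
  replace ((x * (x * 1) - 3 * (y * (y * 1))) /
     ((x * (x * 1) + 3 * (y * (y * 1))) * ((x * (x * 1) + 3 * (y * (y * 1))) * 1)) * (x ^ 2 + 3 * y ^ 2) ^ 2)
    with (x ^ 2 - y ^ 2 * (sqrt 3 * sqrt 3)) by (rewrite E; field; simpl in H; lra).
  field. exact H.
Qed.

Lemma Re_wt_half (l m : Z) (a b : R) : IZR l = a -> IZR m = b ->
  (1/2 - a + b/2) ^ 2 + 3 * (b/2) ^ 2 <> 0 -> (a - b/2) ^ 2 + 3 * (b/2) ^ 2 <> 0 ->
  Re (wt 1 (RtoC (1/2)) l m) = rho (1/2 - a + b/2) (b/2) - rho (a - b/2) (b/2).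
Proof.
  intros <- <- H1 H2.
  set (a := IZR l) in *. set (b := IZR m) in *.
  replace (rho (1/2 - a + b/2) (b/2)) with (rho (1/2 - a + b/2) (- b/2))
    by (unfold rho; replace ((- b / 2) ^ 2) with ((b / 2) ^ 2) by field; reflexivity).
  rewrite <- !Re_inv_sq; auto.
  2:{ replace ((- b / 2) ^ 2) with ((b / 2) ^ 2) by field. auto. }
  unfold wt, Cminus. rewrite re_plus, re_opp.
  replace (lat 1 l m) with ((a - b / 2)%R, (b / 2 * sqrt 3)%R).
  2:{ rewrite lat_eq. unfold omega, RtoC, Cplus, Cmult, a, b. simpl.
      apply injective_projections; simpl; field. }
  replace (RtoC (1/2) + - ((a - b / 2)%R, (b / 2 * sqrt 3)%R))%C with ((1 / 2 - a + b / 2)%R, (- b / 2 * sqrt 3)%R).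
  2:{ unfold RtoC, Cplus, Complex.Copp. apply injective_projections; simpl; field. }
  unfold Rminus. reflexivity.
Qed.

(** The added 4 is 1/z^2 at z = 1/2. *)
Lemma Re_first_shell : 11/2 <= Re (zsum2 (wt0 1 (RtoC (1/2))) 1) + 4.
Proof.
  unfold zsum2. cbn [zsum]. change (Z.of_nat 1) with 1%Z. change (- (1))%Z with (-1)%Z.
  rewrite !re_plus. unfold wt0. cbn [Z.eqb andb].
  change (Re 0) with 0.
  rewrite (Re_wt_half 0 1 0 1), (Re_wt_half 0 (-1) 0 (-1)), (Re_wt_half 1 0 1 0),
    (Re_wt_half 1 1 1 1), (Re_wt_half 1 (-1) 1 (-1)), (Re_wt_half (-1) 0 (-1) 0),
    (Re_wt_half (-1) 1 (-1) 1), (Re_wt_half (-1) (-1) (-1) (-1)) by (reflexivity || lra).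
  unfold rho. lra.
Qed.

Definition wt0_even (l m : Z) : C :=
  (RtoC (1/2) * (wt0 1 (RtoC (1/2)) l m + wt0 1 (RtoC (1/2)) (- l) (- m)))%C.

Lemma zsum2_wt0_even N : zsum2 wt0_even N = zsum2 (wt0 1 (RtoC (1/2))) N.
Proof.
  unfold wt0_even. rewrite zsum2_scal, zsum2_plus, (zsum2_opp (wt0 1 (RtoC (1/2)))).
  set (X := zsum2 _ _). apply injective_projections; simpl; field.
Qed.

(** The paired term equals (3 w^2 - 1/4) / (4 w^2 (w^2 - 1/4)^2). For k >= 2 one has n = |w|^2 >= 3,
    so the corrections 1/4 are at most n/12. Using k^4 >= 2 k^3 then trades the fourth-order decay
    for a smaller constant in the cubic form required by [zsum2_tail]. *)
Lemma wt0_even_bound l m (k : nat) : (1 < k)%nat ->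
  (Z.abs l = Z.of_nat k \/ Z.abs m = Z.of_nat k) ->
  Cmod (wt0_even l m) <= 82/100 / INR k ^ 3.
Proof.
  intros Hk H.
  pose proof (quadratic_form_lower l m k ltac:(lia)) as Hq.
  pose proof (Cmod_lat_sq 1 l m) as Hn. rewrite Cmod_1 in Hn.
  assert (Hk2 : 2 <= INR k) by (apply (le_INR 2); lia).
  set (w := lat 1 l m) in *. set (n := Cmod w ^ 2) in *.
  assert (Hnk : 3/4 * INR k ^ 2 <= n) by (rewrite Hn; lra).
  assert (Hn3 : 3 <= n) by nra.
  assert (Hneg : lat 1 (- l) (- m) = (- w)%C).
  { unfold w, lat. rewrite !opp_IZR, !RtoC_opp. ring. }
  unfold wt0_even, wt0.
  replace ((l =? 0)%Z && (m =? 0)%Z)%bool with false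
    by (symmetry; apply Bool.andb_false_iff; rewrite !Z.eqb_neq; lia).
  replace ((- l =? 0)%Z && (- m =? 0)%Z)%bool with false
    by (symmetry; apply Bool.andb_false_iff; rewrite !Z.eqb_neq; lia).
  unfold wt. rewrite Hneg. fold w.
  assert (Hw0 : Cmod w <> 0) by (intros E; unfold n in Hn3; rewrite E in Hn3; lra).
  assert (Hw : w <> RtoC 0) by (intros E; apply Hw0; now rewrite E, Cmod_0).
  assert (Hsq : Cmod (w * w) = n) by (rewrite Cmod_mult; unfold n; ring).
  assert (Hlow : n - 1/4 <= Cmod (w * w - RtoC (1/4))).
  { pose proof (Cmod_triangle_rev (w * w) (RtoC (1/4))) as HT.
    rewrite Hsq, Cmod_R, Rabs_right in HT; lra. }
  assert (Hup : Cmod (3 * (w * w) - RtoC (1/4)) <= 3 * n + 1/4).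
  { eapply Rle_trans; [apply Cmod_triangle_minus|].
    rewrite Cmod_mult, Hsq, !Cmod_R, !Rabs_right; lra. }
  assert (E14 : RtoC (1/4) = (/ 2 * / 2)%C).
  { apply injective_projections; simpl; field. }
  assert (E12 : RtoC (1/2) = (/ 2)%C).
  { apply injective_projections; simpl; field. }
  assert (Hne : (w * w - / 2 * / 2)%C <> 0).
  { rewrite <- E14. apply Cmod_neq_0. lra. }
  assert (H2 : RtoC 2 <> 0) by (apply Cmod_neq_0; rewrite Cmod_R, Rabs_right; lra).
  assert (Hne1 : (/ 2 - w)%C <> 0).
  { intros E. apply Hne. replace (w * w - / 2 * / 2)%C with (- (/ 2 - w) * (/ 2 + w))%C by ring.
    rewrite E. ring. }
  assert (Hne2 : (/ 2 + w)%C <> 0).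
  { intros E. apply Hne. replace (w * w - / 2 * / 2)%C with (- (/ 2 - w) * (/ 2 + w))%C by ring.
    rewrite E. ring. }
  rewrite E12. rewrite E14 in Hlow, Hup.
  match goal with |- Cmod ?x <= _ =>
   replace x with (/ 2 * / 2 * (3 * (w * w) - / 2 * / 2) *
     / ((w * w) * ((w * w - / 2 * / 2) * (w * w - / 2 * / 2))))%C end.
  2:{ field. cbv beta. repeat split; auto.
      - intros E. apply Hne2.
        replace (/ 2 + w)%C with ((1 - - w * 2) * / 2)%C by (field; auto). rewrite E. ring.
      - intros E. apply Hne1.
        replace (/ 2 - w)%C with ((1 - w * 2) * / 2)%C by (field; auto). rewrite E. ring.
      - intros E. apply Hne.
        replace (w * w - / 2 * / 2)%C with ((w * w * 4 - 1) * (/ 2 * / 2))%C by (field; auto).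
        rewrite E. ring. }
  rewrite !Cmod_mult, !Cmod_inv_total, !Cmod_mult, Cmod_R, Rabs_right by lra.
  replace (Cmod w * Cmod w) with n by (unfold n; ring). clearbody n.
  set (A := Cmod (3 * (w * w) - / 2 * / 2)) in *. set (B := Cmod (w * w - / 2 * / 2)) in *.
  assert (HA : 0 <= A) by apply Cmod_ge_0.
  assert (HB : 11/12 * n <= B) by lra.
  apply Rle_trans with (/ 2 * / 2 * (37/12 * n) * / (n * ((11/12 * n) * (11/12 * n)))).
  - apply Rmult_le_compat; try lra.
    + left. apply Rinv_0_lt_compat. repeat apply Rmult_lt_0_compat; lra.
    + apply Rinv_le_contravar; [repeat apply Rmult_lt_0_compat; lra|].
      apply Rmult_le_compat_l; [lra|]. apply Rmult_le_compat; lra.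
  - assert (Hnn : 9/16 * (2 * INR k ^ 3) <= n ^ 2).
    { apply Rle_trans with ((3/4 * INR k ^ 2) ^ 2); [|apply pow_incr; nra].
      pose proof (pow_lt (INR k) 3 ltac:(lra)). nra. }
    replace (/ 2 * / 2 * (37 / 12 * n) * / (n * (11 / 12 * n * (11 / 12 * n))))
      with ((37/48 * 144/121) * / n ^ 2) by (field; lra).
    apply Rle_trans with ((37/48 * 144/121) * / (9/16 * (2 * INR k ^ 3))).
    + apply Rmult_le_compat_l; [lra|]. apply Rinv_le_contravar; auto.
      pose proof (pow_lt (INR k) 3 ltac:(lra)). lra.
    + replace (37 / 48 * 144 / 121 * / (9 / 16 * (2 * INR k ^ 3)))
        with ((37/48 * 144/121 * 16/18) * / INR k ^ 3) by (field; lra).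
      unfold Rdiv at 5. apply Rmult_le_compat_r; [|lra].
      left. apply Rinv_0_lt_compat, pow_lt. lra.
Qed.

(* Pairing w with -w makes the terms O(|w|^(-4)); the nine central terms contribute at least
   11/2 and the tail at most 8 * 0.82 / (3/2) < 9/2. *)
Lemma Re_wp_half_lower N : (1 <= N)%nat -> 1 <= Re (zsum2 (wt 1 (RtoC (1/2))) N).
Proof.
  intros HN. rewrite zsum2_wt, re_plus, <- zsum2_wt0_even.
  replace N with (1 + (N - 1))%nat by lia.
  pose proof (zsum2_tail wt0_even (82/100) 1 wt0_even_bound ltac:(lra) 1 (le_n _) (N - 1)) as Ht.
  pose proof Re_first_shell as Hf. rewrite <- zsum2_wt0_even in Hf.
  set (X := zsum2 wt0_even (1 + (N - 1))) in *. set (Y := zsum2 wt0_even 1) in *.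
  assert (H4 : Re (/ (RtoC (1/2) * RtoC (1/2))) = 4) by (simpl; field).
  rewrite H4.
  pose proof (re_le_Cmod (X - Y)) as HR. unfold Cminus in HR at 1. rewrite re_plus, re_opp in HR.
  apply Rabs_le_between in HR.
  assert (0 < / (INR (1 + (N - 1)) + 1 / 2)).
  { apply Rinv_0_lt_compat. pose proof (pos_INR (1 + (N - 1))). lra. }
  change (INR 1) with 1 in Ht.
  replace (/ (1 + 1/2)) with (2/3) in Ht by field. lra.
Qed.

(** Multiplying by l1^2 reduces to l1 = 1, where the partial sums have real part at least 1 and so
    cannot tend to 0. *)
Lemma wp_half_period_neq0 (l1 v : C) : l1 <> RtoC 0 ->
  wp_at l1 (Cmul omega l1) (RtoC (1/2) * l1)%C v -> v <> RtoC 0.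
Proof.
  intros Hl H E. apply wp_at_clim in H. destruct H as [_ H]. subst v.
  apply (clim_scal (l1 * l1)%C) in H.
  destruct (H 1 Rlt_0_1) as [N0 HN]. specialize (HN (max 1 N0) ltac:(lia)).
  pose proof (Re_wp_half_lower (max 1 N0) ltac:(lia)) as HR.
  rewrite (zsum2_ext _ (fun l m => / (l1 * l1) * wt 1 (RtoC (1/2)) l m)%C) in HN
    by (intros; apply wt_scale).
  rewrite zsum2_scal in HN. set (X := zsum2 _ _) in *.
  replace (l1 * l1 * (/ (l1 * l1) * X) - l1 * l1 * 0)%C with X in HN by (field; auto).
  pose proof (re_le_Cmod X) as Hx. apply Rabs_le_between in Hx. lra.
Qed.

(** * Inverse square roots *)

Definition csqrt (y : C) : C :=
  (sqrt ((Cmod y + Re y) / 2),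
   (if Rle_dec 0 (Im y) then 1 else -1) * sqrt ((Cmod y - Re y) / 2)).

Lemma csqrt_sq y : (csqrt y * csqrt y = y)%C.
Proof.
  pose proof (re_le_Cmod y) as H. apply Rabs_le_between in H.
  pose proof (Cmod2_alt y) as E.
  set (r := Cmod y) in *. set (a := Re y) in *. set (b := Im y) in *.
  assert (E1 : sqrt ((r + a) / 2) * sqrt ((r + a) / 2) = (r + a) / 2) by (apply sqrt_sqrt; lra).
  assert (E2 : sqrt ((r - a) / 2) * sqrt ((r - a) / 2) = (r - a) / 2) by (apply sqrt_sqrt; lra).
  assert (E3 : sqrt ((r + a) / 2) * sqrt ((r - a) / 2) = Rabs b / 2).
  { rewrite <- sqrt_mult by lra. apply sqrt_lem_1; try nra.
    - pose proof (Rabs_pos b). lra.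
    - pose proof (pow2_abs b). nra. }
  unfold csqrt. fold r a b. destruct y as [y1 y2]. unfold Re, Im in a, b. simpl in a, b.
  apply injective_projections; simpl.
  - destruct Rle_dec; change y1 with a; nra.
  - change y2 with b. destruct Rle_dec as [Hb|Hb].
    + rewrite Rabs_right in E3 by lra. nra.
    + rewrite Rabs_left in E3 by lra. nra.
Qed.

Lemma csqrt_sector y : 0 <= Re y -> Rabs (Im (csqrt y)) <= Re (csqrt y).
Proof.
  intros H0. pose proof (re_le_Cmod y) as H. apply Rabs_le_between in H.
  unfold csqrt, Re at 3, Im at 1. simpl.
  rewrite Rabs_mult. replace (Rabs (if Rle_dec 0 (Im y) then 1 else -1)) with 1.
  2:{ destruct Rle_dec; [rewrite Rabs_right|rewrite Rabs_left]; lra. }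
  rewrite Rmult_1_l, Rabs_right by (apply Rle_ge, sqrt_pos).
  apply sqrt_le_1_alt. lra.
Qed.

(** Vectors in the sector |arg| <= pi/4 enclose an angle of at most pi/2, so adding one does not
    shorten the other. This excludes cancellation between two values of the root. *)
Lemma Cmod_plus_sector (s t : C) : Rabs (Im s) <= Re s -> Rabs (Im t) <= Re t ->
  Cmod s ^ 2 <= Cmod (s + t) ^ 2.
Proof.
  intros Hs Ht. rewrite !Cmod2_alt, re_plus, im_plus.
  apply Rabs_le_between in Hs, Ht. nra.
Qed.

Section InvSqrt.
Variable l1 : C.
Hypothesis l1_neq0 : l1 <> RtoC 0.

(* A branch of the square root on the half-plane {y : Re (y / l1) >= 0}. *)
Definition rot_sqrt (y : C) : C := (csqrt l1 * csqrt (y / l1))%C.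

Lemma rot_sqrt_sq y : (rot_sqrt y * rot_sqrt y = y)%C.
Proof.
  unfold rot_sqrt.
  replace (csqrt l1 * csqrt (y / l1) * (csqrt l1 * csqrt (y / l1)))%C
    with ((csqrt l1 * csqrt l1) * (csqrt (y / l1) * csqrt (y / l1)))%C by ring.
  rewrite !csqrt_sq. field. auto.
Qed.

Lemma Cmod_rot_sqrt y : Cmod (rot_sqrt y) ^ 2 = Cmod y.
Proof. rewrite <- (rot_sqrt_sq y) at 2. rewrite Cmod_mult. ring. Qed.

Lemma rot_sqrt_lower y q : 0 < q -> q ^ 2 <= Cmod y -> q <= Cmod (rot_sqrt y).
Proof.
  intros Hq H. rewrite <- Cmod_rot_sqrt in H. pose proof (Cmod_ge_0 (rot_sqrt y)). nra.
Qed.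

Lemma rot_sqrt_plus_lower y y' q : 0 < q -> q ^ 2 <= Cmod y ->
  0 <= Re (y / l1) -> 0 <= Re (y' / l1) -> q <= Cmod (rot_sqrt y + rot_sqrt y').
Proof.
  intros Hq Hy H H'.
  assert (HH : Cmod (rot_sqrt y) ^ 2 <= Cmod (rot_sqrt y + rot_sqrt y') ^ 2).
  { unfold rot_sqrt. replace (csqrt l1 * csqrt (y / l1) + csqrt l1 * csqrt (y' / l1))%C
      with (csqrt l1 * (csqrt (y / l1) + csqrt (y' / l1)))%C by ring.
    rewrite !Cmod_mult, !Rpow_mult_distr. apply Rmult_le_compat_l; [apply pow2_ge_0|].
    apply Cmod_plus_sector; now apply csqrt_sector. }
  rewrite Cmod_rot_sqrt in HH. pose proof (Cmod_ge_0 (rot_sqrt y + rot_sqrt y')). nra.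
Qed.

Lemma inv_rot_sqrt_bound y q : 0 < q -> q ^ 2 <= Cmod y -> Cmod (/ rot_sqrt y) <= / q.
Proof.
  intros Hq H. rewrite Cmod_inv_total. apply Rinv_le_contravar; auto. now apply rot_sqrt_lower.
Qed.

(** For the roots s, t one has 1/s - 1/t = (t^2 - s^2) / ((s + t) s t), and each of the three
    factors below has modulus at least q. *)
Lemma inv_rot_sqrt_lip y y' q : 0 < q -> q ^ 2 <= Cmod y -> q ^ 2 <= Cmod y' ->
  0 <= Re (y / l1) -> 0 <= Re (y' / l1) ->
  Cmod (/ rot_sqrt y - / rot_sqrt y') <= Cmod (y - y') / q ^ 3.
Proof.
  intros Hq Hy Hy' H H'.
  pose proof (rot_sqrt_plus_lower y y' q Hq Hy H H') as Hp.
  pose proof (rot_sqrt_lower y q Hq Hy) as H1. pose proof (rot_sqrt_lower y' q Hq Hy') as H2.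
  replace (Cmod (y - y')) with (Cmod (y' - y)) by apply Cmod_minus_sym.
  rewrite <- (rot_sqrt_sq y) at 2. rewrite <- (rot_sqrt_sq y') at 2.
  set (s := rot_sqrt y) in *. set (t := rot_sqrt y') in *.
  assert (Hs : s <> RtoC 0) by (apply Cmod_neq_0; lra).
  assert (Ht : t <> RtoC 0) by (apply Cmod_neq_0; lra).
  assert (Hst : (s + t)%C <> RtoC 0) by (apply Cmod_neq_0; lra).
  replace (/ s - / t)%C with ((t * t - s * s) * / (s + t) * / s * / t)%C by (field; auto).
  rewrite !Cmod_mult, !Cmod_inv_total.
  replace (Cmod (t * t - s * s) / q ^ 3) with (Cmod (t * t - s * s) * / q * / q * / q) by (field; lra).
  pose proof (Cmod_ge_0 (t * t - s * s)).
  assert (0 < / Cmod s) by (apply Rinv_0_lt_compat; lra).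
  assert (0 < / Cmod t) by (apply Rinv_0_lt_compat; lra).
  assert (0 < / Cmod (s + t)) by (apply Rinv_0_lt_compat; lra).
  assert (forall x, q <= x -> / x <= / q) by (intros; apply Rinv_le_contravar; auto).
  repeat apply Rmult_le_compat; auto; try lra; repeat apply Rmult_le_pos; lra.
Qed.
End InvSqrt.

(** * A fixed point theorem for bounded sequences *)

(** Banach's theorem in the sup norm, iterating from 0. Phrasing the contraction with an arbitrary
    uniform bound d avoids forming suprema. *)
Lemma fixpoint_seq (T : (nat -> C) -> (nat -> C)) (e : R) : 0 <= e ->
  (forall u, (forall n, Cmod (u n) <= e) -> forall n, Cmod (T u n) <= e) ->
  (forall u v d, (forall n, Cmod (u n) <= e) -> (forall n, Cmod (v n) <= e) ->
     (forall n, Cmod (u n - v n) <= d) -> forall n, Cmod (T u n - T v n) <= d / 2) ->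
  exists u, (forall n, Cmod (u n) <= e) /\ forall n, T u n = u n.
Proof.
  intros He Hball Hlip.
  pose (U := fun m => Nat.iter m T (fun _ => RtoC 0)).
  assert (HU : forall m n, Cmod (U m n) <= e).
  { induction m as [|m IH]; intros n; simpl; [rewrite Cmod_0; auto|]. now apply Hball. }
  assert (Hst : forall m n, Cmod (U (S m) n - U m n) <= 2 * e / 2 ^ m).
  { induction m as [|m IH]; intros n.
    - eapply Rle_trans; [apply Cmod_triangle_minus|].
      pose proof (HU 1%nat n). pose proof (HU 0%nat n). rewrite pow_O. lra.
    - replace (2 * e / 2 ^ S m) with (2 * e / 2 ^ m / 2)
        by (simpl; field; apply pow_nonzero; lra).
      apply (Hlip (U (S m)) (U m)); auto. }
  assert (Hp : forall p m n, Cmod (U (m + p)%nat n - U m n) <= 4 * e / 2 ^ m - 4 * e / 2 ^ (m + p)).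
  { induction p as [|p IH]; intros m n.
    - rewrite Nat.add_0_r. replace (U m n - U m n)%C with (RtoC 0) by ring. rewrite Cmod_0. lra.
    - rewrite Nat.add_succ_r.
      eapply Rle_trans; [apply (Cmod_triangle3 _ (U (m + p)%nat n))|].
      pose proof (Hst (m + p)%nat n). specialize (IH m n).
      replace (4 * e / 2 ^ S (m + p)) with (2 * e / 2 ^ (m + p))
        by (simpl; field; apply pow_nonzero; lra).
      replace (4 * e / 2 ^ (m + p)) with (2 * (2 * e / 2 ^ (m + p))) in IH
        by (field; apply pow_nonzero; lra). lra. }
  assert (Hp4 : forall p m n, Cmod (U (m + p)%nat n - U m n) <= 4 * e / 2 ^ m).
  { intros p m n. eapply Rle_trans; [apply Hp|].
    assert (0 <= 4 * e / 2 ^ (m + p)).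
    { apply Rdiv_le_0_compat; [lra|apply pow_lt; lra]. } lra. }
  assert (Hsmall : forall c eps, 0 < eps -> exists m, c / 2 ^ m < eps).
  { intros c eps Heps. destruct (exists_large c eps Heps) as [m [Hm0 Hm]]. exists m.
    pose proof (pow_lt 2 m ltac:(lra)).
    apply (Rmult_lt_reg_r (2 ^ m)); auto. unfold Rdiv. rewrite Rmult_assoc, Rinv_l by lra.
    assert (INR m <= 2 ^ m).
    { pose proof (poly m 1 ltac:(lra)) as Hb. replace (1 + 1) with 2 in Hb by ring. lra. }
    nra. }
  assert (Hlim : forall n, exists v, clim (fun m => U m n) v).
  { intros n. apply clim_cauchy. intros eps Heps.
    destruct (Hsmall (4 * e) (eps / 2)) as [m Hm]; [lra|].
    exists m. intros p q Hpm Hqm.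
    eapply Rle_lt_trans; [apply (Cmod_triangle3 _ (U m n))|].
    rewrite (Cmod_minus_sym (U m n)).
    pose proof (Hp4 (p - m)%nat m n) as H1. pose proof (Hp4 (q - m)%nat m n) as H2.
    replace (m + (p - m))%nat with p in H1 by lia. replace (m + (q - m))%nat with q in H2 by lia.
    lra. }
  apply choice in Hlim. destruct Hlim as [u Hu].
  assert (Hconst : forall c, clim (fun _ => c) c).
  { intros c eps Heps. exists O. intros. replace (c - c)%C with (RtoC 0) by ring. now rewrite Cmod_0. }
  assert (Hub : forall n, Cmod (u n) <= e).
  { intros n. replace (u n) with (u n - 0)%C by ring.
    apply (clim_dist_le _ (fun _ => RtoC 0) _ _ e (Hu n) (Hconst _)).
    intros N. replace (U N n - 0)%C with (U N n) by ring. apply HU. }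
  assert (Hd : forall m n, Cmod (u n - U m n) <= 4 * e / 2 ^ m).
  { intros m n.
    assert (Hu' : clim (fun p => U (m + p)%nat n) (u n)).
    { intros eps Heps. destruct (Hu n eps Heps) as [N0 HN]. exists N0. intros; apply HN; lia. }
    apply (clim_dist_le _ (fun _ => U m n) _ _ _ Hu' (Hconst _)). intros; apply Hp4. }
  exists u. split; auto. intros n.
  apply NNPP. intros Hn.
  assert (Hpos : 0 < Cmod (T u n - u n)).
  { apply Cmod_gt_0. intros E. apply Hn. now apply Ceq_minus. }
  destruct (Hsmall (8 * e) _ Hpos) as [m Hm].
  pose proof (Hlip u (U m) _ Hub (HU m) (Hd m) n) as H1.
  pose proof (Hd (S m) n) as H2. rewrite Cmod_minus_sym in H2.
  pose proof (Cmod_triangle3 (T u n) (T (U m) n) (u n)) as H3.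
  change (U (S m) n) with (T (U m) n) in H2.
  assert (Hpm : 0 < 2 ^ m) by (apply pow_lt; lra).
  replace (4 * e / 2 ^ S m) with (2 * e / 2 ^ m) in H2 by (simpl; field; lra).
  replace (8 * e / 2 ^ m) with (2 * (4 * e / 2 ^ m)) in Hm by (field; lra).
  replace (2 * e / 2 ^ m) with (4 * e / 2 ^ m / 2) in H2 by (field; lra).
  assert (0 <= 4 * e / 2 ^ m) by (apply Rdiv_le_0_compat; lra).
  lra.
Qed.

(** * Parameters with prescribed itinerary *)

Lemma exp_INR_mult x n : exp (INR n * x) = exp x ^ n.
Proof.
  induction n as [|n IH]; [simpl; rewrite Rmult_0_l; apply exp_0|].
  rewrite S_INR, Rmult_plus_distr_r, Rmult_1_l, exp_plus, IH. simpl. ring.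
Qed.

Section Itinerary.
Variables (l1 e1 : C) (b0 : nat).
Hypothesis l1_neq0 : l1 <> RtoC 0.
Hypothesis e1_neq0 : e1 <> RtoC 0.

(** The bound |l1|/8 stays inside the disc where [wp_reg] converges and keeps offsets small against
    lattice distances; |e1|/8 keeps [param] within 1/8 of 1. *)
Definition rad : R := Rmin (Cmod l1 / 8) (Cmod e1 / 8).
Definition lipc : R := 1824 / Cmod l1 ^ 3.
Definition gap : R := sqrt (Cmod l1 / 2).

(** These make, in turn, the error terms at most a quarter of q^2, the ball of radius [rad]
    invariant, and the Lipschitz constant at most 1/2. *)
Hypothesis b0_perturb : 4 * ((8/7 * rad + lipc * rad) / Cmod l1) <= 2 ^ b0.
Hypothesis b0_ball : / (gap * rad) <= 2 ^ b0.
Hypothesis b0_contract : 2 * (10 * Cmod l1 / Cmod e1 + 2 + lipc) / gap ^ 3 <= 2 ^ b0.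

(* The letters of level k form a square of side [M k] = [q k ^ 2]. *)
Definition q (k : nat) : R := 2 ^ (k + b0).
Definition M (k : nat) : nat := (4 ^ (k + b0))%nat.

(* The coefficients are kept in the cone [2M, 3M) x [0, M), so that the centres lie in a
   sector around the direction of l1 on which one branch of the square root is available. *)
Definition centre (w : nat -> nat * nat) (k : nat) : C :=
  lat l1 (2 * Z.of_nat (M k) + Z.of_nat (fst (w k))) (Z.of_nat (snd (w k))).

Definition param (u0 : C) : C := (1 + u0 / e1)%C.

Definition preimage_target (w : nat -> nat * nat) (k : nat) (u0 u' u : C) : C :=
  ((centre w k + u') / param u0 - wp_reg l1 u)%C.

(** * Estimates for the system of equations *)

Lemma l1_pos : 0 < Cmod l1. Proof. now apply Cmod_gt_0. Qed.
Lemma e1_pos : 0 < Cmod e1. Proof. now apply Cmod_gt_0. Qed.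

Lemma rad_pos : 0 < rad.
Proof. pose proof l1_pos. pose proof e1_pos. apply Rmin_glb_lt; lra. Qed.
Lemma rad_le_l1 : rad <= Cmod l1 / 8. Proof. apply Rmin_l. Qed.
Lemma rad_le_e1 : rad <= Cmod e1 / 8. Proof. apply Rmin_r. Qed.

Lemma lipc_pos : 0 < lipc.
Proof. apply Rdiv_lt_0_compat; [lra|]. apply pow_lt, l1_pos. Qed.

Lemma gap_pos : 0 < gap.
Proof. apply sqrt_lt_R0. pose proof l1_pos. lra. Qed.
Lemma gap_sq : gap ^ 2 = Cmod l1 / 2.
Proof. unfold gap. pose proof l1_pos. rewrite pow2_sqrt; lra. Qed.

Lemma q_ge_b0 k : 2 ^ b0 <= q k.
Proof. unfold q. apply Rle_pow; [lra|lia]. Qed.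
Lemma q_ge1 k : 1 <= q k.
Proof. apply pow_R1_Rle. lra. Qed.
Lemma q_ge_INR k : INR k <= q k.
Proof.
  apply Rle_trans with (2 ^ k).
  - pose proof (poly k 1 ltac:(lra)) as Hb. replace (1 + 1) with 2 in Hb by ring. lra.
  - apply Rle_pow; [lra|lia].
Qed.
Lemma INR_M k : INR (M k) = q k ^ 2.
Proof.
  unfold M, q. rewrite pow_INR, <- pow_mult, Nat.mul_comm, pow_mult. f_equal. simpl. ring.
Qed.
Lemma M_gt0 k : (0 < M k)%nat.
Proof. unfold M. pose proof (Nat.pow_nonzero 4 (k + b0)). lia. Qed.

Lemma letters_bound w k : letters M w -> (fst (w k) < M k /\ snd (w k) < M k)%nat.
Proof.
  intros H. specialize (H k). destruct (w k) as [a b]. unfold square in H.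
  apply in_prod_iff in H. rewrite !in_seq in H. simpl. lia.
Qed.

Lemma param_shift_small u0 : Cmod u0 <= rad -> Cmod (u0 / e1) <= 1/8.
Proof.
  intros H. rewrite Cmod_div by auto. pose proof e1_pos. pose proof rad_le_e1.
  apply (Rmult_le_reg_r (Cmod e1)); auto. unfold Rdiv at 1.
  rewrite Rmult_assoc, Rinv_l by lra. lra.
Qed.

Lemma param_bounds u0 : Cmod u0 <= rad -> 7/8 <= Cmod (param u0) <= 9/8.
Proof.
  intros H. apply param_shift_small in H. unfold param.
  pose proof (Cmod_triangle 1 (u0 / e1)) as H1.
  pose proof (Cmod_triangle_rev 1 (- (u0 / e1))) as H2.
  rewrite Cmod_opp, Cmod_1 in H2. rewrite Cmod_1 in H1.
  replace (1 - - (u0 / e1))%C with (1 + u0 / e1)%C in H2 by ring. lra.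
Qed.

Lemma param_neq0 u0 : Cmod u0 <= rad -> param u0 <> RtoC 0.
Proof. intros H. apply Cmod_neq_0. pose proof (param_bounds u0 H). lra. Qed.

Lemma inv_param_bound u0 : Cmod u0 <= rad -> Cmod (/ param u0) <= 8/7.
Proof.
  intros H. rewrite Cmod_inv_total. pose proof (param_bounds u0 H).
  replace (8/7) with (/ (7/8)) by field. apply Rinv_le_contravar; lra.
Qed.

Lemma wp_reg_bound u : Cmod u <= rad -> Cmod (wp_reg l1 u) <= lipc * rad.
Proof.
  intros H. pose proof rad_le_l1. pose proof l1_pos. pose proof lipc_pos.
  pose proof (wp_reg_lip l1 u 0 l1_neq0) as HL. rewrite wp_reg_0, Cmod_0 in HL by auto.
  replace (wp_reg l1 u - 0)%C with (wp_reg l1 u) in HL by ring.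
  replace (u - 0)%C with u in HL by ring.
  eapply Rle_trans; [apply HL; lra|]. fold lipc. apply Rmult_le_compat_l; lra.
Qed.

Lemma wp_reg_lip_rad u v : Cmod u <= rad -> Cmod v <= rad ->
  Cmod (wp_reg l1 u - wp_reg l1 v) <= lipc * Cmod (u - v).
Proof.
  intros H H'. pose proof rad_le_l1. pose proof l1_pos. apply wp_reg_lip; auto; lra.
Qed.

Definition tau (w : nat -> nat * nat) (k : nat) : C :=
  (RtoC (IZR (2 * Z.of_nat (M k) + Z.of_nat (fst (w k)))) + RtoC (IZR (Z.of_nat (snd (w k)))) * omega)%C.

Lemma centre_tau w k : centre w k = (tau w k * l1)%C.
Proof. apply lat_eq. Qed.

(** For a letter (a, b) with a, b < q^2 the real part is 2 q^2 + a - b/2. The offset 2 q^2 leaves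
    room for the perturbations of the target. *)
Lemma tau_bounds w k : letters M w ->
  3/2 * q k ^ 2 <= Re (tau w k) /\ Cmod (tau w k) <= 4 * q k ^ 2.
Proof.
  intros Hw. destruct (letters_bound w k Hw) as [Ha Hb].
  apply lt_INR in Ha, Hb. rewrite INR_M in Ha, Hb.
  pose proof (pos_INR (fst (w k))). pose proof (pos_INR (snd (w k))).
  unfold tau. rewrite plus_IZR, mult_IZR, <- !INR_IZR_INZ, INR_M. split.
  - unfold omega. simpl. lra.
  - eapply Rle_trans; [apply Cmod_triangle|].
    rewrite Cmod_mult, Cmod_omega, !Cmod_R, !Rabs_right by nra. lra.
Qed.

Lemma centre_upper w k : letters M w -> Cmod (centre w k) <= 4 * q k ^ 2 * Cmod l1.
Proof.
  intros Hw. rewrite centre_tau, Cmod_mult. apply Rmult_le_compat_r; [apply Cmod_ge_0|].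
  now apply tau_bounds.
Qed.

Lemma centre_lower w k : letters M w -> 3/2 * q k ^ 2 * Cmod l1 <= Cmod (centre w k).
Proof.
  intros Hw. rewrite centre_tau, Cmod_mult. apply Rmult_le_compat_r; [apply Cmod_ge_0|].
  destruct (tau_bounds w k Hw). pose proof (re_le_Cmod (tau w k)) as H1.
  apply Rabs_le_between in H1. lra.
Qed.

Lemma preimage_target_bounds w k u0 u' u : letters M w ->
  Cmod u0 <= rad -> Cmod u' <= rad -> Cmod u <= rad ->
  let y := preimage_target w k u0 u' u in
  0 <= Re (y / l1) /\ (gap * q k) ^ 2 <= Cmod y /\ Cmod y <= 5 * q k ^ 2 * Cmod l1.
Proof.
  intros Hw H0 H1 H2 y.
  pose proof l1_pos as Hl. pose proof (param_neq0 u0 H0) as Hp.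
  pose proof (param_shift_small u0 H0) as Hx. pose proof (inv_param_bound u0 H0) as Hi.
  set (p := param u0) in *. set (x := (u0 / e1)%C) in *.
  set (E := ((u' * / p - wp_reg l1 u) / l1)%C).
  (* With p = 1 + x, dividing by p changes tau by tau x / p. In units of q^2 the parts are at least
     3/2 in real part, then at most 4/7 and 1/4, so the real part stays above 1/2; the modulus is at
     most 4 + 4/7 + 1/4 < 5. *)
  assert (Ey : (y / l1 = tau w k - tau w k * (x * / p) + E)%C).
  { unfold y, preimage_target, E. fold p. rewrite centre_tau.
    assert (Ep : p = (1 + x)%C) by reflexivity.
    replace x with (p - 1)%C by (rewrite Ep; ring). field. auto. }
  assert (HE : Cmod E <= q k ^ 2 / 4).
  { apply Rle_trans with ((8/7 * rad + lipc * rad) / Cmod l1).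
    - unfold E. rewrite Cmod_div by auto. unfold Rdiv. apply Rmult_le_compat_r.
      + left. now apply Rinv_0_lt_compat.
      + eapply Rle_trans; [apply Cmod_triangle_minus|]. rewrite Cmod_mult.
        pose proof (wp_reg_bound u H2). pose proof (Cmod_ge_0 u'). pose proof (Cmod_ge_0 (/ p)).
        assert (Cmod u' * Cmod (/ p) <= rad * (8/7)) by (apply Rmult_le_compat; auto). lra.
    - pose proof (q_ge_b0 k). pose proof (q_ge1 k). nra. }
  assert (Hxp : Cmod (x * / p) <= 1/7).
  { rewrite Cmod_mult. pose proof (Cmod_ge_0 x). pose proof (Cmod_ge_0 (/ p)).
    replace (1/7) with (1/8 * (8/7)) by field. apply Rmult_le_compat; auto. }
  destruct (tau_bounds w k Hw) as [Ht1 Ht2].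
  assert (Htx : Cmod (tau w k * (x * / p)) <= 4/7 * q k ^ 2).
  { rewrite Cmod_mult. replace (4/7 * q k ^ 2) with (4 * q k ^ 2 * (1/7)) by field.
    apply Rmult_le_compat; auto; apply Cmod_ge_0. }
  assert (Hq2 : 0 < q k ^ 2) by (pose proof (q_ge1 k); apply pow_lt; lra).
  assert (HRe : q k ^ 2 / 2 <= Re (y / l1)).
  { rewrite Ey. unfold Cminus. rewrite !re_plus, re_opp.
    pose proof (re_le_Cmod (tau w k * (x * / p))) as R1. pose proof (re_le_Cmod E) as R2.
    apply Rabs_le_between in R1, R2. lra. }
  assert (Eyl : Cmod y = Cmod (y / l1) * Cmod l1).
  { rewrite <- Cmod_mult. f_equal. field. auto. }
  split; [lra|split].
  - rewrite Rpow_mult_distr, gap_sq, Eyl.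
    pose proof (re_le_Cmod (y / l1)) as R1. apply Rabs_le_between in R1.
    replace (Cmod l1 / 2 * q k ^ 2) with (q k ^ 2 / 2 * Cmod l1) by field.
    apply Rmult_le_compat_r; lra.
  - rewrite Eyl. apply Rmult_le_compat_r; [lra|]. rewrite Ey.
    pose proof (Cmod_triangle (tau w k - tau w k * (x * / p)) E).
    pose proof (Cmod_triangle_minus (tau w k) (tau w k * (x * / p))). lra.
Qed.

(** The growth q^2 comes from the change of [param], which divides the large centre; the other two
    variables contribute bounded constants. Against the q^(-3) of the inverse root this leaves a
    contraction of order 1/q. *)
Lemma preimage_target_lip w k u0 u' u v0 v' v d : letters M w ->
  Cmod u0 <= rad -> Cmod u' <= rad -> Cmod u <= rad ->
  Cmod v0 <= rad -> Cmod v' <= rad -> Cmod v <= rad ->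
  Cmod (u0 - v0) <= d -> Cmod (u' - v') <= d -> Cmod (u - v) <= d ->
  Cmod (preimage_target w k u0 u' u - preimage_target w k v0 v' v)
    <= q k ^ 2 * (10 * Cmod l1 / Cmod e1 + 2 + lipc) * d.
Proof.
  intros Hw H0 H1 H2 H3 H4 H5 D0 D1 D2.
  pose proof l1_pos as Hl. pose proof e1_pos as He.
  pose proof (param_neq0 u0 H0) as Hp. pose proof (param_neq0 v0 H3) as Hp'.
  pose proof (inv_param_bound u0 H0) as Hi. pose proof (inv_param_bound v0 H3) as Hi'.
  pose proof (wp_reg_lip_rad u v H2 H5) as HL. pose proof lipc_pos.
  assert (Hd : 0 <= d) by (pose proof (Cmod_ge_0 (u - v)); lra).
  assert (Epp : (param v0 - param u0 = (v0 - u0) / e1)%C) by (unfold param; field; auto).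
  unfold preimage_target. set (c := centre w k) in *.
  set (p := param u0) in *. set (p' := param v0) in *.
  replace ((c + u') / p - wp_reg l1 u - ((c + v') / p' - wp_reg l1 v))%C
    with ((c + u') * ((p' - p) * (/ p * / p')) + (u' - v') * / p' - (wp_reg l1 u - wp_reg l1 v))%C
    by (field; auto).
  eapply Rle_trans; [apply Cmod_triangle_minus|].
  eapply Rle_trans; [apply Rplus_le_compat_r, Cmod_triangle|].
  rewrite Epp, !Cmod_mult, (Cmod_div _ e1) by auto.
  assert (Hq2 : 1 <= q k ^ 2) by (pose proof (q_ge1 k); nra).
  assert (Hc : Cmod (c + u') <= 5 * q k ^ 2 * Cmod l1).
  { eapply Rle_trans; [apply Cmod_triangle|]. pose proof (centre_upper w k Hw) as Hcu. fold c in Hcu.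
    pose proof rad_le_l1. nra. }
  assert (Hpp : Cmod (/ p) * Cmod (/ p') <= 2).
  { pose proof (Cmod_ge_0 (/ p)). pose proof (Cmod_ge_0 (/ p')).
    apply Rle_trans with (8/7 * (8/7)); [apply Rmult_le_compat; auto|lra]. }
  assert (Hvu : Cmod (v0 - u0) / Cmod e1 <= d / Cmod e1).
  { unfold Rdiv. apply Rmult_le_compat_r; [left; now apply Rinv_0_lt_compat|].
    now rewrite Cmod_minus_sym. }
  assert (T1 : Cmod (c + u') * (Cmod (v0 - u0) / Cmod e1 * (Cmod (/ p) * Cmod (/ p')))
     <= 5 * q k ^ 2 * Cmod l1 * (d / Cmod e1 * 2)).
  { assert (0 <= Cmod (v0 - u0) / Cmod e1) by (apply Rdiv_le_0_compat; [apply Cmod_ge_0|auto]).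
    assert (0 <= Cmod (/ p) * Cmod (/ p')) by (apply Rmult_le_pos; apply Cmod_ge_0).
    apply Rmult_le_compat; auto; [apply Cmod_ge_0|now apply Rmult_le_pos|].
    apply Rmult_le_compat; auto. }
  assert (T2 : Cmod (u' - v') * Cmod (/ p') <= d * 2).
  { apply Rmult_le_compat; auto; try apply Cmod_ge_0. lra. }
  assert (T3 : Cmod (wp_reg l1 u - wp_reg l1 v) <= lipc * d).
  { eapply Rle_trans; [exact HL|]. apply Rmult_le_compat_l; lra. }
  replace (q k ^ 2 * (10 * Cmod l1 / Cmod e1 + 2 + lipc) * d)
    with (5 * q k ^ 2 * Cmod l1 * (d / Cmod e1 * 2) + q k ^ 2 * (d * 2 + lipc * d))
    by (field; lra).
  assert (0 <= d * 2 + lipc * d) by nra. nra.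
Qed.

Lemma itinerary_exists w : letters M w ->
  exists u : nat -> C, (forall n, Cmod (u n) <= rad) /\
    forall n, u n <> RtoC 0 /\ (/ (u n * u n) = preimage_target w n (u 0%nat) (u (S n)) (u n))%C.
Proof.
  intros Hw. pose proof gap_pos as Hg. pose proof rad_pos as Hr.
  assert (Hgq : forall k, 0 < gap * q k).
  { intros k. pose proof (q_ge1 k). apply Rmult_lt_0_compat; lra. }
  destruct (fixpoint_seq (fun u n => / rot_sqrt l1 (preimage_target w n (u 0%nat) (u (S n)) (u n)))%C rad)
    as [u [Hu1 Hu2]].
  - lra.
  - intros u Hu n.
    destruct (preimage_target_bounds w n (u 0%nat) (u (S n)) (u n) Hw (Hu _) (Hu _) (Hu _)) as (_ & H & _).
    eapply Rle_trans; [apply inv_rot_sqrt_bound with (q := gap * q n); auto|].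
    pose proof (q_ge_b0 n) as Hq.
    rewrite <- (Rinv_inv rad). apply Rinv_le_contravar; [now apply Rinv_0_lt_compat|].
    assert (Hi : / (gap * rad) <= q n) by lra.
    apply (Rmult_le_compat_l gap) in Hi; [|lra].
    replace (gap * / (gap * rad)) with (/ rad) in Hi by (field; lra). exact Hi.
  - intros u v d Hu Hv Hd n.
    destruct (preimage_target_bounds w n (u 0%nat) (u (S n)) (u n) Hw (Hu _) (Hu _) (Hu _)) as (A1 & A2 & _).
    destruct (preimage_target_bounds w n (v 0%nat) (v (S n)) (v n) Hw (Hv _) (Hv _) (Hv _)) as (B1 & B2 & _).
    eapply Rle_trans; [apply inv_rot_sqrt_lip with (q := gap * q n); auto|].
    pose proof (preimage_target_lip w n _ _ _ _ _ _ d Hw (Hu 0%nat) (Hu (S n)) (Hu n)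
      (Hv 0%nat) (Hv (S n)) (Hv n) (Hd _) (Hd _) (Hd _)) as HL.
    set (K := 10 * Cmod l1 / Cmod e1 + 2 + lipc) in *.
    pose proof (q_ge_b0 n) as Hq. pose proof (q_ge1 n) as Hq1.
    assert (Hg3 : 0 < gap ^ 3) by (apply pow_lt; auto).
    assert (HK : 2 * K <= q n * gap ^ 3).
    { apply (Rmult_le_reg_r (/ gap ^ 3)); [now apply Rinv_0_lt_compat|].
      replace (q n * gap ^ 3 * / gap ^ 3) with (q n) by (field; lra). unfold Rdiv in b0_contract. lra. }
    assert (Hd0 : 0 <= d) by (pose proof (Cmod_ge_0 (u n - v n)); pose proof (Hd n); lra).
    assert (Hgq3 : 0 < (gap * q n) ^ 3) by (apply pow_lt; auto).
    apply (Rmult_le_reg_r ((gap * q n) ^ 3)); auto.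
    unfold Rdiv at 1. rewrite Rmult_assoc, Rinv_l, Rmult_1_r by lra.
    eapply Rle_trans; [exact HL|].
    replace (d / 2 * (gap * q n) ^ 3) with (q n ^ 2 * (d / 2) * (q n * gap ^ 3)) by field.
    replace (q n ^ 2 * K * d) with (q n ^ 2 * (d / 2) * (2 * K)) by field.
    apply Rmult_le_compat_l; auto. pose proof (pow2_ge_0 (q n)). nra.
  - exists u. split; auto. intros n.
    destruct (preimage_target_bounds w n (u 0%nat) (u (S n)) (u n) Hw (Hu1 _) (Hu1 _) (Hu1 _)) as (_ & A2 & _).
    specialize (Hu2 n). set (y := preimage_target _ _ _ _ _) in *.
    assert (Hs : rot_sqrt l1 y <> RtoC 0).
    { apply Cmod_neq_0. pose proof (rot_sqrt_lower l1 l1_neq0 y (gap * q n) (Hgq n) A2).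
      specialize (Hgq n). lra. }
    rewrite <- Hu2. split.
    + intros E. apply C1_nz. rewrite <- (Cinv_r _ Hs), E. ring.
    + rewrite <- (rot_sqrt_sq l1 l1_neq0 y) at 3. field. auto.
Qed.

(** * Escape of the prescribed orbits *)

Definition has_itinerary (w : nat -> nat * nat) (u : nat -> C) : Prop :=
  (forall n, Cmod (u n) <= rad) /\
  forall n, u n <> RtoC 0 /\ (/ (u n * u n) = preimage_target w n (u 0%nat) (u (S n)) (u n))%C.

Lemma itinerary_recurrence w u n : has_itinerary w u ->
  (/ (u n * u n) + wp_reg l1 (u n) = (centre w n + u (S n)) / param (u 0%nat))%C.
Proof. intros [_ H]. destruct (H n) as [_ ->]. unfold preimage_target. ring. Qed.

Lemma itinerary_wp w u n (l m : Z) : has_itinerary w u ->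
  wp_at l1 (Cmul omega l1) (u n + lat l1 l m)%C ((centre w n + u (S n)) / param (u 0%nat))%C.
Proof.
  intros H. rewrite <- itinerary_recurrence by auto. destruct H as [H1 H2].
  apply wp_at_shift; auto. apply wp_at_small; auto.
  - apply H2.
  - pose proof rad_le_l1. pose proof l1_pos. specialize (H1 n). lra.
Qed.

Hypothesis e1_lattice : in_lattice l1 (Cmul omega l1) e1.
Hypothesis e1_value : wp_at l1 (Cmul omega l1) (RtoC (1/2) * l1)%C e1.

Definition orbit (w : nat -> nat * nat) (u : nat -> C) (n : nat) : C :=
  match n with
  | O => (RtoC (1/2) * l1)%C
  | S O => (u O + e1)%C
  | S (S k) => (u (S k) + centre w k)%C
  end.

Lemma orbit_step w u n : has_itinerary w u ->
  exists v, wp_at l1 (Cmul omega l1) (orbit w u n) v /\ orbit w u (S n) = (param (u 0%nat) * v)%C.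
Proof.
  intros H.
  assert (Hp : param (u 0%nat) <> RtoC 0) by (apply param_neq0, H).
  destruct n as [|[|n]].
  - exists e1. split; auto. simpl. unfold param. field. auto.
  - exists ((centre w 0 + u 1%nat) / param (u 0%nat))%C. split.
    + destruct e1_lattice as (l & m & E). change (e1 = lat l1 l m) in E. cbn [orbit].
      rewrite E at 1. now apply itinerary_wp.
    + cbn [orbit]. field. auto.
  - exists ((centre w (S n) + u (S (S n))) / param (u 0%nat))%C. split.
    + cbn [orbit]. now apply itinerary_wp.
    + cbn [orbit]. field. auto.
Qed.

Lemma orbit_escapes w u : letters M w -> has_itinerary w u ->
  escapes l1 (Cmul omega l1) (param (u 0%nat)) (RtoC (1/2) * l1)%C.
Proof.
  intros Hw H. exists (orbit w u). split; [reflexivity|split].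
  - intros n. now apply orbit_step.
  - intros B. pose proof l1_pos as Hl.
    destruct (exists_large B (Cmod l1) Hl) as [N [_ HN]].
    exists (S (S N)). intros n Hn. destruct n as [|[|n]]; try lia.
    rewrite Cabs_Cmod. cbn [orbit].
    pose proof (centre_lower w n Hw) as H1. destruct H as [H2 _]. specialize (H2 (S n)).
    pose proof rad_le_l1. pose proof (q_ge1 n). pose proof (q_ge_INR n).
    assert (INR N <= INR n) by (apply le_INR; lia).
    pose proof (Cmod_triangle_rev (centre w n) (- u (S n))) as HT. rewrite Cmod_opp in HT.
    replace (centre w n - - u (S n))%C with (u (S n) + centre w n)%C in HT by ring.
    assert (q n <= q n ^ 2) by nra.
    assert (INR N * Cmod l1 <= q n ^ 2 * Cmod l1) by (apply Rmult_le_compat_r; lra).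
    assert (1 * Cmod l1 <= q n ^ 2 * Cmod l1) by (apply Rmult_le_compat_r; lra).
    lra.
Qed.

(** * Expansion along orbits and separation of parameters *)

Definition invc : R := sqrt (5 * Cmod l1).
Definition stepc : R := 6 * Cmod l1 + 9/8 * (2 * invc ^ 3 + lipc) + 1.

(** Bounds |u n - u' n| by parameter distance while the letters agree. The start reflects u_0 = e1
    (beta - 1); the extra 1 here and in [stepc] keeps all factors at least 1. *)
Fixpoint lipn (n : nat) : R :=
  match n with O => 1 + Cmod e1 | S k => stepc * q k ^ 3 * lipn k end.

Lemma invc_ge0 : 0 <= invc. Proof. apply sqrt_pos. Qed.

Lemma stepc_ge1 : 1 <= stepc.
Proof.
  unfold stepc. pose proof l1_pos. pose proof lipc_pos. pose proof (pow_le invc 3 invc_ge0). lra.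
Qed.

Lemma q3_ge k : q k <= q k ^ 3.
Proof. pose proof (q_ge1 k). nra. Qed.

Lemma lipn_ge1 n : 1 <= lipn n.
Proof.
  induction n as [|n IH]; simpl lipn.
  - pose proof e1_pos. lra.
  - pose proof stepc_ge1. pose proof (q_ge1 n). pose proof (q3_ge n).
    assert (1 <= stepc * q n ^ 3) by nra. nra.
Qed.

Lemma inv_itinerary_bound w u n : letters M w -> has_itinerary w u ->
  Cmod (/ u n) <= invc * q n.
Proof.
  intros Hw [H1 H2]. destruct (H2 n) as [Hn E].
  destruct (preimage_target_bounds w n (u 0%nat) (u (S n)) (u n) Hw (H1 _) (H1 _) (H1 _)) as (_ & _ & A).
  rewrite <- E, Cmod_inv_total, Cmod_mult, Rinv_mult, <- Cmod_inv_total in A.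
  pose proof l1_pos. pose proof (q_ge1 n). pose proof invc_ge0.
  assert (Hs : invc ^ 2 = 5 * Cmod l1) by (unfold invc; rewrite pow2_sqrt; lra).
  pose proof (Cmod_ge_0 (/ u n)).
  apply Rsqr_incr_0_var; [|nra]. unfold Rsqr.
  replace (invc * q n * (invc * q n)) with (invc ^ 2 * q n ^ 2) by ring. rewrite Hs. lra.
Qed.

(** With s = 1/u and s' = 1/u', both O(q), the difference of 1/u^2 and 1/u'^2 is (u' - u) s s' (s +
    s'), which gives q^3. The factor 6 rounds up 5 * 8/7, and 9/8 bounds the parameter. *)
Lemma itinerary_step_lip w w' u u' n : letters M w -> letters M w' ->
  has_itinerary w u -> has_itinerary w' u' ->
  Cmod ((centre w n + u (S n)) - (centre w' n + u' (S n)))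
   <= q n ^ 3 * (6 * Cmod l1 * Cmod (param (u 0%nat) - param (u' 0%nat))
                 + 9/8 * (2 * invc ^ 3 + lipc) * Cmod (u n - u' n)).
Proof.
  intros Hw Hw' H H'.
  pose proof (itinerary_recurrence w u n H) as R1.
  pose proof (itinerary_recurrence w' u' n H') as R2.
  pose proof (inv_itinerary_bound w u n Hw H) as S1.
  pose proof (inv_itinerary_bound w' u' n Hw' H') as S2.
  pose proof (param_neq0 _ (proj1 H 0%nat)) as P1. pose proof (param_neq0 _ (proj1 H' 0%nat)) as P2.
  pose proof (proj1 (proj2 H n)) as N1. pose proof (proj1 (proj2 H' n)) as N2.
  pose proof (param_bounds _ (proj1 H' 0%nat)) as PB.
  pose proof (inv_param_bound _ (proj1 H 0%nat)) as PI.
  pose proof (wp_reg_lip_rad _ _ (proj1 H n) (proj1 H' n)) as HL.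
  pose proof l1_pos as Hl. pose proof lipc_pos as Hc. pose proof invc_ge0 as Hi.
  pose proof (q_ge1 n) as Hq. pose proof (q3_ge n) as Hq3.
  assert (HV : Cmod ((centre w n + u (S n)) / param (u 0%nat)) <= 6 * q n ^ 2 * Cmod l1).
  { unfold Cdiv. rewrite Cmod_mult.
    apply Rle_trans with ((5 * q n ^ 2 * Cmod l1) * (8/7)).
    - apply Rmult_le_compat; auto; try apply Cmod_ge_0.
      eapply Rle_trans; [apply Cmod_triangle|]. pose proof (centre_upper w n Hw).
      pose proof rad_le_l1. pose proof (proj1 H (S n)). nra.
    - nra. }
  set (p := param (u 0%nat)) in *. set (p' := param (u' 0%nat)) in *.
  replace (centre w n + u (S n))%C with (p * ((centre w n + u (S n)) / p))%C by (field; auto).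
  replace (centre w' n + u' (S n))%C with (p' * ((centre w' n + u' (S n)) / p'))%C by (field; auto).
  rewrite <- R2. set (V := ((centre w n + u (S n)) / p)%C) in *.
  set (s := (/ u n)%C) in *. set (s' := (/ u' n)%C) in *.
  replace (p * V - p' * (/ (u' n * u' n) + wp_reg l1 (u' n)))%C
    with ((p - p') * V + p' * ((u' n - u n) * (s * s' * (s + s')) + (wp_reg l1 (u n) - wp_reg l1 (u' n))))%C
    by (rewrite <- R1; unfold s, s'; field; auto).
  eapply Rle_trans; [apply Cmod_triangle|]. rewrite !Cmod_mult.
  set (X := Cmod (p - p')). set (Y := Cmod (u n - u' n)) in *.
  assert (HX : 0 <= X) by apply Cmod_ge_0. assert (HY : 0 <= Y) by apply Cmod_ge_0.
  assert (HW : Cmod ((u' n - u n) * (s * s' * (s + s')) + (wp_reg l1 (u n) - wp_reg l1 (u' n)))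
      <= q n ^ 3 * ((2 * invc ^ 3 + lipc) * Y)).
  { eapply Rle_trans; [apply Cmod_triangle|]. rewrite !Cmod_mult, (Cmod_minus_sym (u' n)). fold Y.
    assert (Hss : Cmod (s + s') <= 2 * (invc * q n)).
    { eapply Rle_trans; [apply Cmod_triangle|]. lra. }
    assert (Hm : Cmod s * Cmod s' * Cmod (s + s') <= (invc * q n) * (invc * q n) * (2 * (invc * q n))).
    { apply Rmult_le_compat; auto; try apply Cmod_ge_0.
      - apply Rmult_le_pos; apply Cmod_ge_0.
      - apply Rmult_le_compat; auto; apply Cmod_ge_0. }
    apply (Rmult_le_compat_l Y) in Hm; auto.
    replace (q n ^ 3 * ((2 * invc ^ 3 + lipc) * Y))
      with (Y * (invc * q n * (invc * q n) * (2 * (invc * q n))) + q n ^ 3 * (lipc * Y)) by ring.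
    assert (lipc * Y <= q n ^ 3 * (lipc * Y)) by (assert (0 <= lipc * Y) by nra; nra).
    lra. }
  assert (T1 : X * Cmod V <= X * (6 * q n ^ 3 * Cmod l1)).
  { apply Rmult_le_compat_l; auto. eapply Rle_trans; [exact HV|].
    assert (q n ^ 2 <= q n ^ 3) by (simpl; nra). nra. }
  assert (T2 : Cmod p' * Cmod ((u' n - u n) * (s * s' * (s + s')) + (wp_reg l1 (u n) - wp_reg l1 (u' n)))
     <= 9/8 * (q n ^ 3 * ((2 * invc ^ 3 + lipc) * Y))).
  { apply Rmult_le_compat; try apply Cmod_ge_0; tauto. }
  lra.
Qed.

Lemma lipn_step w w' u u' n : letters M w -> letters M w' ->
  has_itinerary w u -> has_itinerary w' u' ->
  Cmod (u n - u' n) <= lipn n * Cmod (param (u 0%nat) - param (u' 0%nat)) ->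
  Cmod ((centre w n + u (S n)) - (centre w' n + u' (S n)))
   <= lipn (S n) * Cmod (param (u 0%nat) - param (u' 0%nat)).
Proof.
  intros Hw Hw' H H' Hn.
  eapply Rle_trans; [now apply itinerary_step_lip|].
  set (X := Cmod (param (u 0%nat) - param (u' 0%nat))) in *.
  assert (HX : 0 <= X) by apply Cmod_ge_0.
  cbn [lipn]. pose proof (lipn_ge1 n) as HL. pose proof (q_ge1 n). pose proof (q3_ge n).
  pose proof l1_pos. pose proof lipc_pos. pose proof (pow_le invc 3 invc_ge0) as Hi.
  replace (stepc * q n ^ 3 * lipn n * X) with (q n ^ 3 * (stepc * (lipn n * X))) by ring.
  apply Rmult_le_compat_l; [lra|]. unfold stepc.
  set (A := 9/8 * (2 * invc ^ 3 + lipc)). assert (HA : 0 <= A) by (unfold A; lra).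
  assert (X <= lipn n * X) by nra.
  assert (A * Cmod (u n - u' n) <= A * (lipn n * X)) by now apply Rmult_le_compat_l.
  assert (6 * Cmod l1 * X <= 6 * Cmod l1 * (lipn n * X)) by (apply Rmult_le_compat_l; lra).
  lra.
Qed.

Lemma centre_ext w w' k : w k = w' k -> centre w k = centre w' k.
Proof. unfold centre. now intros ->. Qed.

Lemma itinerary_lip w w' u u' n : letters M w -> letters M w' ->
  has_itinerary w u -> has_itinerary w' u' -> (forall j, (j < n)%nat -> w j = w' j) ->
  Cmod (u n - u' n) <= lipn n * Cmod (param (u 0%nat) - param (u' 0%nat)).
Proof.
  intros Hw Hw' H H'. induction n as [|n IH]; intros Hag.
  - replace (u 0%nat - u' 0%nat)%C with (e1 * (param (u 0%nat) - param (u' 0%nat)))%C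
      by (unfold param; field; auto).
    rewrite Cmod_mult. simpl. apply Rmult_le_compat_r; [apply Cmod_ge_0|lra].
  - replace (u (S n) - u' (S n))%C with ((centre w n + u (S n)) - (centre w' n + u' (S n)))%C.
    + apply lipn_step; auto.
    + rewrite (centre_ext w w' n) by (apply Hag; lia). ring.
Qed.

Definition sepn (n : nat) : R := Cmod l1 / (2 * lipn (S n)).

Lemma Rabs_INR_minus a b :
  Rabs (INR a - INR b) = INR (Z.abs_nat (Z.of_nat a - Z.of_nat b)).
Proof.
  rewrite !INR_IZR_INZ, <- minus_IZR, <- abs_IZR. f_equal. lia.
Qed.

(** At the first difference the centres differ by a lattice vector of modulus at least 3/4 k |l1|,
    and the two offsets take away at most |l1|/4. For k >= 1 half of k |l1| remains, whence the 2 in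
    [sepn]. *)
Lemma itinerary_separation w w' u u' n : letters M w -> letters M w' ->
  has_itinerary w u -> has_itinerary w' u' -> (forall j, (j < n)%nat -> w j = w' j) ->
  sepn n * Rabs (INR (fst (w n)) - INR (fst (w' n))) <= Cmod (param (u 0%nat) - param (u' 0%nat)) /\
  sepn n * Rabs (INR (snd (w n)) - INR (snd (w' n))) <= Cmod (param (u 0%nat) - param (u' 0%nat)).
Proof.
  intros Hw Hw' H H' Hag.
  pose proof (lipn_step w w' u u' n Hw Hw' H H' (itinerary_lip w w' u u' n Hw Hw' H H' Hag)) as HU.
  set (X := Cmod (param (u 0%nat) - param (u' 0%nat))) in *.
  assert (HX : 0 <= X) by apply Cmod_ge_0.
  pose proof (lipn_ge1 (S n)) as HL. pose proof l1_pos as Hl. pose proof rad_le_l1.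
  set (a := (Z.of_nat (fst (w n)) - Z.of_nat (fst (w' n)))%Z).
  set (b := (Z.of_nat (snd (w n)) - Z.of_nat (snd (w' n)))%Z).
  assert (Hc : (centre w n - centre w' n = lat l1 a b)%C).
  { unfold centre, lat, a, b. rewrite !minus_IZR, !plus_IZR, !RtoC_minus, !RtoC_plus. ring. }
  assert (HD : Cmod (lat l1 a b) - Cmod l1 / 4 <= lipn (S n) * X).
  { eapply Rle_trans; [|exact HU].
    replace (centre w n + u (S n) - (centre w' n + u' (S n)))%C
      with (lat l1 a b - (u' (S n) - u (S n)))%C by (rewrite <- Hc; ring).
    eapply Rle_trans; [|apply Cmod_triangle_rev].
    pose proof (Cmod_triangle_minus (u' (S n)) (u (S n))).
    pose proof (proj1 H (S n)). pose proof (proj1 H' (S n)). lra. }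
  assert (HF : forall k : nat, (Z.of_nat k <= Z.abs a \/ Z.of_nat k <= Z.abs b)%Z ->
     sepn n * INR k <= X).
  { intros k Hk. pose proof (lat_lower l1 a b k Hk) as Hlow.
    destruct k as [|k]; [simpl; lra|].
    assert (1 <= INR (S k)) by (apply (le_INR 1); lia).
    unfold sepn. apply (Rmult_le_reg_l (2 * lipn (S n))); [lra|].
    replace (2 * lipn (S n) * (Cmod l1 / (2 * lipn (S n)) * INR (S k)))
      with (Cmod l1 * INR (S k)) by (field; lra).
    nra. }
  split; rewrite Rabs_INR_minus; apply HF; unfold a, b; lia.
Qed.

(** * Scales and mass of the Cantor set *)

Lemma sepn_pos n : 0 < sepn n.
Proof. apply Rdiv_lt_0_compat; [apply l1_pos|]. pose proof (lipn_ge1 (S n)). lra. Qed.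

Lemma sepn_decr n : sepn (S n) <= sepn n.
Proof.
  unfold sepn, Rdiv. pose proof l1_pos. apply Rmult_le_compat_l; [lra|].
  pose proof (lipn_ge1 (S n)). apply Rinv_le_contravar; [lra|].
  change (lipn (S (S n))) with (stepc * q (S n) ^ 3 * lipn (S n)).
  pose proof stepc_ge1. pose proof (q_ge1 (S n)). pose proof (q3_ge (S n)).
  assert (1 <= stepc * q (S n) ^ 3) by nra. nra.
Qed.

Lemma sepn_lim r : 0 < r -> exists n, sepn n <= r.
Proof.
  intros Hr. destruct (exists_large (Cmod l1) r Hr) as [n [_ Hn]]. exists n.
  pose proof (lipn_ge1 n). pose proof stepc_ge1. pose proof (q_ge_INR n). pose proof (q_ge1 n).
  pose proof (q3_ge n).
  assert (INR n <= lipn (S n)).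
  { cbn [lipn]. assert (q n ^ 3 <= stepc * q n ^ 3) by nra. nra. }
  pose proof (lipn_ge1 (S n)). unfold sepn.
  apply (Rmult_le_reg_r (2 * lipn (S n))); [lra|].
  replace (Cmod l1 / (2 * lipn (S n)) * (2 * lipn (S n))) with (Cmod l1) by (field; lra). nra.
Qed.

(* The logarithm of [q 0 * ... * q (n - 1)]. *)
Definition lnq (n : nat) : R := ln 2 * (INR n * INR b0 + INR n * (INR n - 1) / 2).

Lemma q_exp k : q k = exp (ln 2 * (INR k + INR b0)).
Proof.
  unfold q. rewrite <- plus_INR, Rmult_comm, <- Rpower_pow by lra. reflexivity.
Qed.

Lemma lnq_S n : lnq (S n) = lnq n + ln 2 * (INR n + INR b0).
Proof. unfold lnq. rewrite S_INR. field. Qed.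

Lemma lipn_exp n : lipn n = exp (ln (1 + Cmod e1) + INR n * ln stepc + 3 * lnq n).
Proof.
  pose proof e1_pos. pose proof stepc_ge1.
  induction n as [|n IH].
  - unfold lnq. simpl. replace (_ + 0 * _ + _) with (ln (1 + Cmod e1)) by field.
    rewrite exp_ln; lra.
  - cbn [lipn]. rewrite IH, q_exp, lnq_S, S_INR.
    rewrite <- (exp_ln stepc) at 1 by lra. rewrite <- exp_INR_mult.
    rewrite <- !exp_plus. f_equal. replace (INR 3) with 3 by (simpl; lra). ring.
Qed.

Lemma prodn_M_exp n : prodn (fun k => INR (M k) ^ 2) n = exp (4 * lnq n).
Proof.
  induction n as [|n IH]; cbn [prodn].
  - unfold lnq. simpl. rewrite <- exp_0. f_equal. field.
  - rewrite IH, INR_M, q_exp, lnq_S, <- !exp_INR_mult, <- exp_plus. f_equal.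
    replace (INR 2) with 2 by (simpl; lra). ring.
Qed.

(** The logarithm of the product is a quadratic a n^2 + b n + c whose leading coefficient (4 - 3 s)
    ln 2 / 2 is positive because s < 4/3. Its minimum over the reals is c - b^2 / (4 a). *)
Lemma mass_lower_bound s : 0 < s < 4/3 -> exists c, 0 < c /\ forall n,
  c <= Rpower (sepn n * INR (M n)) s * prodn (fun k => INR (M k) ^ 2) n.
Proof.
  intros Hs. pose proof e1_pos as He. pose proof l1_pos as Hl. pose proof stepc_ge1 as Hc.
  assert (Hln2 : 0 < ln 2) by (rewrite <- ln_1; apply ln_increasing; lra).
  set (A := (ln (Cmod l1 / 2) - ln stepc - ln (1 + Cmod e1))).
  set (a := (4 - 3 * s) * ln 2 / 2).
  set (b := (4 - 3 * s) * ln 2 * (INR b0 - 1/2) - s * (ln stepc + ln 2)).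
  set (c := s * (A - ln 2 * INR b0)).
  assert (Ha : 0 < a) by (unfold a; nra).
  exists (exp (c - b ^ 2 / (4 * a))). split; [apply exp_pos|]. intros n.
  assert (E : sepn n * INR (M n) = exp (A - INR n * ln stepc - ln 2 * (INR n + INR b0) - 3 * lnq n)).
  { unfold sepn. cbn [lipn]. rewrite INR_M, lipn_exp.
    replace (Cmod l1 / (2 * (stepc * q n ^ 3 * exp (ln (1 + Cmod e1) + INR n * ln stepc + 3 * lnq n))) * q n ^ 2)
      with (Cmod l1 / 2 * / stepc * / q n * / exp (ln (1 + Cmod e1) + INR n * ln stepc + 3 * lnq n)).
    2:{ field. pose proof (q_ge1 n). pose proof (exp_pos (ln (1 + Cmod e1) + INR n * ln stepc + 3 * lnq n)).
        repeat split; lra. }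
    rewrite <- (exp_ln (Cmod l1 / 2)) by lra. rewrite <- (exp_ln stepc) at 1 by lra.
    rewrite q_exp, <- !exp_Ropp, <- !exp_plus. f_equal. unfold A. ring. }
  rewrite E, prodn_M_exp. unfold Rpower. rewrite ln_exp, <- exp_plus.
  assert (Hle : c - b ^ 2 / (4 * a) <= a * INR n ^ 2 + b * INR n + c).
  { assert (0 <= a * (INR n + b / (2 * a)) ^ 2).
    { apply Rmult_le_pos; [lra|apply pow2_ge_0]. }
    replace (a * (INR n + b / (2 * a)) ^ 2) with (a * INR n ^ 2 + b * INR n + b ^ 2 / (4 * a)) in H
      by (field; lra). lra. }
  replace (s * (A - INR n * ln stepc - ln 2 * (INR n + INR b0) - 3 * lnq n) + 4 * lnq n)
    with (a * INR n ^ 2 + b * INR n + c) by (unfold a, b, c, lnq; field).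
  destruct Hle as [Hlt|Heq]; [left; now apply exp_increasing|rewrite Heq; lra].
Qed.
End Itinerary.

(** * Escaping parameters *)

Lemma escapes_omega (l1 beta c : C) : l1 <> RtoC 0 ->
  escapes l1 (Cmul omega l1) beta c -> escapes l1 (Cmul omega l1) beta (omega * c)%C.
Proof.
  intros Hl (x & H0 & Hs & Hlim). exists (fun n => omega * x n)%C. split; [now rewrite H0|split].
  - intros n. destruct (Hs n) as (v & Hv & E). exists (omega * v)%C. split.
    + now apply wp_at_omega.
    + rewrite E. change (Cmul beta v) with (beta * v)%C.
      change (@eq C (omega * (beta * v))%C (beta * (omega * v))%C). ring.
  - intros B. destruct (Hlim B) as [N HN]. exists N. intros n Hn. specialize (HN n Hn).
    rewrite Cabs_Cmod, Cmod_mult, Cmod_omega, Rmult_1_l, <- Cabs_Cmod. exact HN.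
Qed.

Lemma escapes_shift (l1 beta c : C) l m : l1 <> RtoC 0 ->
  escapes l1 (Cmul omega l1) beta c -> escapes l1 (Cmul omega l1) beta (c + lat l1 l m)%C.
Proof.
  intros Hl (x & H0 & Hs & Hlim).
  exists (fun n => match n with O => (c + lat l1 l m)%C | S _ => x n end).
  split; [reflexivity|split].
  - intros n. destruct (Hs n) as (v & Hv & E). exists v. split; auto.
    destruct n as [|n]; auto. rewrite H0 in Hv. now apply wp_at_shift.
  - intros B. destruct (Hlim B) as [N HN]. exists (S N). intros n Hn.
    destruct n as [|n]; [lia|]. apply HN. lia.
Qed.

Lemma escapes_all_crit (l1 beta : C) : l1 <> RtoC 0 ->
  escapes l1 (Cmul omega l1) beta (RtoC (1/2) * l1)%C ->
  forall i, In i (1 :: 2 :: 3 :: nil)%nat ->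
  escapes l1 (Cmul omega l1) beta (crit_pt l1 (Cmul omega l1) i).
Proof.
  intros Hl H i Hi.
  assert (H2 : escapes l1 (Cmul omega l1) beta (omega * (RtoC (1/2) * l1))%C)
    by now apply escapes_omega.
  destruct Hi as [<-|[<-|[<-|[]]]].
  - exact H.
  - replace (crit_pt l1 (Cmul omega l1) 2) with (omega * (RtoC (1/2) * l1))%C; auto.
    change (@eq C (omega * (RtoC (1/2) * l1))%C (RtoC (1/2) * (omega * l1))%C). ring.
  (* Since 1 + omega = -omega^2, the third critical point is -omega^2 l1 / 2, which is omega^2 l1 /
     2 translated by l1 + omega l1. *)
  - replace (crit_pt l1 (Cmul omega l1) 3) with (omega * (omega * (RtoC (1/2) * l1)) + lat l1 1 1)%C.
    + apply escapes_shift, escapes_omega; auto.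
    + change (@eq C (omega * (omega * (RtoC (1/2) * l1)) + lat l1 1 1)%C
        (RtoC (1/2) * (l1 + omega * l1))%C).
      replace (omega * (omega * (RtoC (1/2) * l1)))%C with (omega * omega * (RtoC (1/2) * l1))%C by ring.
      rewrite omega_sq. unfold lat.
      replace (RtoC (IZR 1)) with (RtoC (1/2) + RtoC (1/2))%C
        by (apply injective_projections; simpl; field).
      replace (- (1) - omega)%C with (- (RtoC (1/2) + RtoC (1/2)) - omega)%C
        by (apply injective_projections; simpl; field).
      replace (omega * l1)%C with ((RtoC (1/2) + RtoC (1/2)) * (omega * l1))%C at 3
        by (apply injective_projections; simpl; field).
      apply injective_projections; simpl; field.
Qed.

Theorem mainTheorem1 (l1 : Cplx) (hl1 : l1 <> C0)
  (hcrit : forall i, In i (1 :: 2 :: 3 :: nil)%nat ->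
     exists v, wp_at l1 (Cmul omega l1) (crit_pt l1 (Cmul omega l1) i) v /\
               in_lattice l1 (Cmul omega l1) v) :
  hausdorff_dim_ge (escaping_params l1 (Cmul omega l1)) (4/3).
Proof.
  change (l1 <> RtoC 0) in hl1.
  destruct (hcrit 1%nat) as (e1 & Hval & Hlat); [now left|].
  change (crit_pt l1 (Cmul omega l1) 1) with (RtoC (1/2) * l1)%C in Hval.
  pose proof (wp_half_period_neq0 l1 e1 hl1 Hval) as He1.
  set (B1 := 4 * ((8/7 * rad l1 e1 + lipc l1 * rad l1 e1) / Cmod l1)).
  set (B2 := / (gap l1 * rad l1 e1)).
  set (B3 := 2 * (10 * Cmod l1 / Cmod e1 + 2 + lipc l1) / gap l1 ^ 3).
  assert (Hb : exists b, B1 <= 2 ^ b /\ B2 <= 2 ^ b /\ B3 <= 2 ^ b).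
  { destruct (exists_large (Rmax B1 (Rmax B2 B3)) 1 Rlt_0_1) as [b [_ Hb]]. exists b.
    assert (INR b <= 2 ^ b).
    { pose proof (poly b 1 ltac:(lra)) as Hp. replace (1 + 1) with 2 in Hp by ring. lra. }
    pose proof (Rmax_l B1 (Rmax B2 B3)). pose proof (Rmax_r B1 (Rmax B2 B3)).
    pose proof (Rmax_l B2 B3). pose proof (Rmax_r B2 B3). lra. }
  destruct Hb as (b0 & Hb1 & Hb2 & Hb3).
  (* Words outside the alphabets receive the zero sequence as a default, so that [choice] yields a
     function on all words. *)
  assert (Hit : forall w, exists u, letters (M b0) w -> has_itinerary l1 e1 b0 w u).
  { intros w. destruct (classic (letters (M b0) w)) as [Hw|Hw].
    - destruct (itinerary_exists l1 e1 b0 hl1 He1 Hb1 Hb2 Hb3 w Hw) as [u Hu].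
      exists u. intros _. exact Hu.
    - exists (fun _ => RtoC 0). tauto. }
  apply choice in Hit. destruct Hit as [u Hu].
  intros s Hs Hnull. apply Rnot_lt_le. intros Hlt.
  destruct (mass_lower_bound l1 e1 b0 hl1 He1 s (conj Hs Hlt)) as [c [Hc Hmass]].
  revert Hnull.
  apply (not_hausdorff_null (fun w => param e1 (u w 0%nat)) (M b0) (sepn l1 e1 b0) s c); auto.
  - apply M_gt0.
  - now apply sepn_pos.
  - now apply sepn_decr.
  - now apply sepn_lim.
  - lra.
  - intros w Hw. split.
    + apply (param_neq0 l1 e1 He1). apply (Hu w Hw).
    + apply escapes_all_crit; auto.
      apply (orbit_escapes l1 e1 b0) with (w := w); auto.
  - intros w w' n Hw Hw' Hag.
    apply (itinerary_separation l1 e1 b0) with (w := w) (w' := w'); auto.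
Qed.
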